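(* Let $d>1$ be a fixed integer, and consider complete multipartite graphs $K_{n_1,n_2,\ldots,n_d}$ (with parts of sizes $n_1,\dots,n_d$, every pair of vertices in different parts joined by an edge, and no edges within a part), with $n=n_1+\cdots+n_d$, such that as $n\to\infty$ one has $n_i/n\to c_i$ for a positive constant $c_i$, for each $i=1,\dots,d$. Take two independent spanning trees of $K_{n_1,\ldots,n_d}$, each chosen uniformly at random among all its spanning trees. Then the number of edges common to the two trees converges in distribution to a Poisson random variable with expected value $$\sum_{1\le i<j\le d}\frac{c_ic_j(2-c_i-c_j)^2}{(1-c_i)^2(1-c_j)^2}.$$ *)

(* Defs.v *)
From HB Require Import structures.
From mathcomp Require Import all_boot all_order all_algebra.
From mathcomp Require Import all_classical all_reals all_analysis.

Set Implicit Arguments.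
Unset Strict Implicit.
Unset Printing Implicit Defensive.

Import Order.TTheory GRing.Theory Num.Theory.
Import numFieldNormedType.Exports.

(* A simple graph on a finite type V is given by a symmetric irreflexive
   adjacency relation; an edge is the two-element set of its endpoints. *)
Section Graphs.
Variable V : finType.

Definition edges (e : rel V) : {set {set V}} :=
  [set f : {set V} | [exists x, exists y, e x y && (f == [set x; y]%SET)]]%SET.

Definition adj (F : {set {set V}}) : rel V := [rel x y | [set x; y]%SET \in F].

Definition connected_edges (F : {set {set V}}) : Prop :=
  forall x y : V, connect (adj F) x y.

(* A cycle visits at least three vertices, each of them once. *)
Definition acyclic_edges (F : {set {set V}}) : Prop :=
  forall p : seq V, (2 < size p)%N -> ~~ ucycleb (adj F) p.

Definition is_spanning_tree (e : rel V) (F : {set {set V}}) : Prop :=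
  [/\ F \subset edges e, connected_edges F & acyclic_edges F].

Definition spanning_trees (e : rel V) : {set {set {set V}}} :=
  [set F : {set {set V}} | `[< is_spanning_tree e F >]]%SET.

End Graphs.

(* Vertices of K_{n_1,...,n_d}: pairs of a part i and a position in it. *)
Definition multipartite_vertex (d : nat) (n : 'I_d -> nat) : finType :=
  {i : 'I_d & 'I_(n i)}.

Definition multipartite (d : nat) (n : 'I_d -> nat) :
    rel (multipartite_vertex n) :=
  fun u v => tag u != tag v.
Arguments multipartite {d} n.

Local Open Scope classical_set_scope.
Local Open Scope ring_scope.

(* Finite sets over a finite type form a finite type, which carries the
   discrete sigma-algebra. *)
HB.instance Definition _ (E : finType) := isPointed.Build {set E} (@finset.set0 E).

HB.instance Definition _ (E : finType) :=
  @isMeasurable.Build default_measure_display {set E}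
    discrete_measurable discrete_measurable0
    discrete_measurableC discrete_measurableU.

Section RandomVariables.
Context {d : measure_display} {T : measurableType d} {R : realType}.
Variable P : probability T R.

(* For nonempty A, the masses of the points of A add up to 1, so that the other
   values have probability 0. For A empty, the condition is vacuous. *)
Definition uniform_on (E : finType) (S : {RV P >-> {set E}})
    (A : {set {set E}}) : Prop :=
  forall a, a \in A -> P (S @^-1` [set a]) = (#|A|%:R^-1 : R)%:E.

Definition independent_RVs d1 d2
    (T1 : measurableType d1) (T2 : measurableType d2)
    (X : {RV P >-> T1}) (Y : {RV P >-> T2}) : Prop :=
  forall A B, measurable A -> measurable B ->
    P (X @^-1` A `&` Y @^-1` B) = (P (X @^-1` A) * P (Y @^-1` B))%E.

Definition common (E : finType) (S S' : {RV P >-> {set E}}) : T -> R :=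
  fun w => #|S w :&: S' w|%:R.

Lemma measurable_common (E : finType) (S S' : {RV P >-> {set E}}) :
  measurable_fun setT (common S S').
Proof.
move=> _ B mB; rewrite setTI.
rewrite (_ : _ @^-1` _ = \bigcup_(A in [set: {set E}])
    (S @^-1` [set A] `&` S' @^-1` [set A' | B (#|A :&: A'|%:R)])); last first.
  apply/seteqP; split=> w /=; first by move=> Bw; exists (S w).
  by move=> [A _ [SwA]]; rewrite /common SwA.
apply: fin_bigcup_measurable => // A _; apply: measurableI.
- exact: (measurable_funPTI S).
- exact: (measurable_funPTI S').
Qed.

HB.instance Definition _ (E : finType) (S S' : {RV P >-> {set E}}) :=
  isMeasurableFun.Build _ _ _ _ (common S S') (measurable_common S S').

Definition num_common (E : finType) (S S' : {RV P >-> {set E}}) :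
  {RV P >-> R} := common S S'.

End RandomVariables.

Definition natr_fun {R : realType} : nat -> R := fun k => k%:R.

Lemma measurable_natr_fun {R : realType} :
  measurable_fun setT (@natr_fun R).
Proof. by []. Qed.

HB.instance Definition _ (R : realType) :=
  isMeasurableFun.Build _ _ _ _ (@natr_fun R) measurable_natr_fun.

(* The second argument of the library's poisson_prob is a dummy. *)
Definition poisson_RV {R : realType} (rate : R) :
  {RV (poisson_prob rate 0) >-> R} := @natr_fun R.

Definition cvg_in_distribution {R : realType}
    (d_ : nat -> measure_display) (T_ : forall k, measurableType (d_ k))
    (P_ : forall k, probability (T_ k) R) (X_ : forall k, {RV (P_ k) >-> R})
    (d : measure_display) (T : measurableType d) (P : probability T R)
    (X : {RV P >-> R}) : Prop :=
  forall r : R, {for r, continuous (cdf X)} ->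
    cdf (X_ k) r @[k --> \oo] --> cdf X r.

(* Main.v *)
Require Import Defs.
From mathcomp Require Import all_boot all_order all_algebra all_fingroup.
From mathcomp Require Import all_classical all_reals all_analysis.
From mathcomp Require Import zify ring lra.
Import Order.TTheory GRing.Theory Num.Theory.
Import numFieldNormedType.Exports.

(* Let N be the number of vertices, G the graph, and L its Laplacian. By
   Cauchy-Binet, a set A of edges is contained in a uniform spanning tree with
   probability det K_A, where K_A is the Gram matrix (b_f^T H b_g) of the
   incidence vectors b_f, f in A, for any inverse H of L modulo constants. For a
   complete multipartite graph, L + J is block diagonal with blocks
   (N - n_i) I + J, so H is explicit: K_A has diagonal entries
   (1 - 1/N) (1/(N - n_i) + 1/(N - n_j)), and its off-diagonal entries are
   O(1/N^2) unless the two edges meet. The r-th factorial moment of the number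
   of common edges is the sum of det(K_A)^2 over r-tuples A of edges. Up to
   O(1/N) it is the r-th power of the sum of K_ff^2 over the edges f, which
   tends to the stated rate; Bonferroni's inequalities turn the convergence of
   moments into that of the point probabilities. *)

Set Implicit Arguments.
Unset Strict Implicit.
Unset Printing Implicit Defensive.

Local Open Scope ring_scope.

(** * Determinants *)

(** The Laplacian is singular. It is grounded: the unit row of a root [x0], carried by [None] in
    [option {set V}], joins the incidence matrix, so that the Gram matrix of a connected graph
    becomes invertible and its determinant is the number of spanning trees, with no minor to choose.
    That a spanning tree exists then follows from the invertibility.

    Containment is read off a polynomial: the edges of A get the weight ['X], and the coefficient of
    degree |A| counts the trees that contain A.

    Edges that meet are the obstacle in the moments, since there the kernel is of order 1/N, as on
    the diagonal. But they make up only O(N^3) of the O(N^4) pairs, so the absolute values of the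
    kernel still sum to O(N^2). Tuples with a repeated edge have determinant 0 and need not be
    excluded, which makes the main term an exact power.

    The rate arises as follows: an edge between parts i and j has probability about (1/(1 - c_i) +
    1/(1 - c_j))/N, both trees must contain it, and there are about c_i c_j N^2 such edges. *)

Lemma det_one_add_mulC (K : comUnitRingType) m n (U : 'M[K]_(m, n)) (W : 'M[K]_(n, m)) :
  \det (1%:M + U *m W) = \det (1%:M + W *m U).
Proof.
have E1 : block_mx (1%:M + U *m W) U 0 1%:M *m block_mx 1%:M 0 (- W) 1%:M
        = block_mx 1%:M U (- W) 1%:M.
  by rewrite mulmx_block !(mulmx1, mul1mx, mulmx0, mul0mx, add0r, addr0) mulmxN addrK.
have E2 : block_mx 1%:M 0 (- W) 1%:M *m block_mx 1%:M U 0 (1%:M + W *m U)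
        = block_mx 1%:M U (- W) 1%:M.
  rewrite mulmx_block !(mulmx1, mul1mx, mulmx0, mul0mx, add0r, addr0).
  by rewrite mulNmx [_ + W *m U]addrC addKr.
have := congr1 determinant E1; rewrite -E2 !det_mulmx !det_ublock !det_lblock !det1.
by rewrite !(mulr1, mul1r).
Qed.

(** Cauchy-Binet with all functions in place of n-subsets: the n! orderings of a subset contribute
    equally, a non-injective function contributes 0, and no order on [T] has to be chosen. *)
Lemma gram_det (K : comPzRingType) (T : finType) n (w : T -> K) (a : T -> 'I_n -> K) :
  n`!%:R * \det (\matrix_(i, j) \sum_o w o * a o i * a o j) =
  \sum_(f : {ffun 'I_n -> T})
     (\prod_i w (f i)) * (\det (\matrix_(i, j) a (f i) j)) ^+ 2.
Proof.
have E : \det (\matrix_(i, j) \sum_o w o * a o i * a o j) =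
    \sum_(f : {ffun 'I_n -> T}) (\prod_i w (f i)) * (\prod_i a (f i) i)
      * \det (\matrix_(i, j) a (f i) j).
  rewrite /determinant.
  under [RHS]eq_bigr do rewrite mulr_sumr.
  rewrite exchange_big /=; apply: eq_bigr => s _.
  under eq_bigr do rewrite mxE.
  rewrite bigA_distr_bigA mulr_sumr; apply: eq_bigr => f _.
  rewrite mulrCA; congr (_ * _); rewrite !big_split /=; congr (_ * _).
  by apply: eq_bigr => i _; rewrite mxE.
(* Relabelling the rows by [s] turns the diagonal monomial into the [s]-term of a second
   determinant. Adding these n! equal expressions produces the square. *)
have Es (s : 'S_n) : \det (\matrix_(i, j) \sum_o w o * a o i * a o j) =
    \sum_(f : {ffun 'I_n -> T}) (\prod_i w (f i)) * \det (\matrix_(i, j) a (f i) j)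
      * ((-1) ^+ s * \prod_i (\matrix_(i, j) a (f i) j) i (s i)).
  rewrite E (reindex (fun f : {ffun 'I_n -> T} => [ffun i => f ((s^-1)%g i)])) /=; last first.
    exists (fun f : {ffun 'I_n -> T} => [ffun i => f (s i)]) => f _;
      by apply/ffunP => i; rewrite !ffunE ?permK ?permKV.
  apply: eq_bigr => f _.
  have -> : \prod_i w ([ffun i => f ((s^-1)%g i)] i) = \prod_i w (f i).
    rewrite [RHS](reindex_inj (@perm_inj _ (s^-1)%g)) /=.
    by apply: eq_bigr => i _; rewrite ffunE.
  have -> : \prod_i a ([ffun i => f ((s^-1)%g i)] i) i = \prod_i (\matrix_(i, j) a (f i) j) i (s i).
    rewrite [RHS](reindex_inj (@perm_inj _ (s^-1)%g)) /=.
    by apply: eq_bigr => i _; rewrite ffunE mxE permKV.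
  have -> : (\matrix_(i, j) a ([ffun i => f ((s^-1)%g i)] i) j)
      = row_perm (s^-1)%g (\matrix_(i, j) a (f i) j).
    by apply/matrixP => i j; rewrite !mxE ffunE.
  rewrite row_permE det_mulmx det_perm odd_permV -!mulrA; congr (_ * _).
  by rewrite mulrC -!mulrA mulrCA [RHS]mulrC -!mulrA mulrCA; congr (_ * _); rewrite mulrC.
transitivity (\sum_(s : 'S_n) \det (\matrix_(i, j) \sum_o w o * a o i * a o j)).
  by rewrite sumr_const card_Sn mulr_natl.
under eq_bigr => s _ do rewrite (Es s).
rewrite exchange_big /=; apply: eq_bigr => f _.
by rewrite -mulr_sumr expr2 mulrA.
Qed.

(** The size bound belongs to the induction: it makes the contribution of [p i] vanish in the top
    degree. *)
Lemma size_coef_prod_linear (K : comNzRingType) (I : Type) (s : seq I) (p q : I -> K) :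
  (size (\prod_(i <- s) ((p i)%:P + (q i)%:P * 'X))%R <= (size s).+1)%N /\
  (\prod_(i <- s) ((p i)%:P + (q i)%:P * 'X))`_(size s) = \prod_(i <- s) q i.
Proof.
elim: s => [|i s [IHs IHc]]; first by rewrite !big_nil size_poly1 coefC eqxx.
rewrite !big_cons /= mulrDl; split.
  apply: leq_trans (size_polyD _ _) _; rewrite geq_max; apply/andP; split.
    rewrite mul_polyC; apply: leq_trans (size_scale_leq _ _) _; exact: leqW.
  rewrite -mulrA mul_polyC; apply: leq_trans (size_scale_leq _ _) _.
  by rewrite mulrC; apply: leq_trans (size_mul_leq _ _) _; rewrite size_polyX addn2 ltnS.
rewrite coefD coefCM [X in p i * X]nth_default // mulr0 add0r.
by rewrite mulrAC coefMX /= coefCM IHc.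
Qed.

(** Each Leibniz term is a product of r linear factors, so its coefficient of degree r is the
    product of the slopes. *)
Lemma coef_det_linear (K : comNzRingType) r (A B : 'M[K]_r) :
  (\det (map_mx polyC A + 'X *: map_mx polyC B))`_r = \det B.
Proof.
rewrite /determinant coef_sum; apply: eq_bigr => s _.
have -> : (-1) ^+ s = ((-1) ^+ s)%:P :> {poly K} by rewrite rmorphXn rmorphN1.
rewrite coefCM; congr (_ * _).
have := (size_coef_prod_linear (index_enum 'I_r) (fun i => A i (s i)) (fun i => B i (s i))).2.
have -> : size (index_enum 'I_r) = r by rewrite -[index_enum _]enumT size_enum_ord.
move=> <-; congr (polyseq _)`_r; apply: eq_bigr => i _.
by rewrite !mxE mulrC.
Qed.

(** * Spanning trees and incidence matrices *)

Section IncidenceMatrix.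
Variables (V : finType) (x0 : V).
Implicit Types (F : {set {set V}}) (f : {set V}).

(** An arbitrary orientation of the edges; [x0] is only the default for sets with fewer than two
    elements. *)
Definition hd f : V := odflt x0 [pick x in f].
Definition tl f : V := odflt x0 [pick x in f :\ hd f].

Lemma hd_tl f : #|f| = 2%N -> f = [set hd f; tl f]%SET /\ hd f != tl f.
Proof.
move=> f2; have hf : hd f \in f.
  rewrite /hd; case: pickP => //= f0; move: f2.
  by rewrite eq_card0.
have tf : tl f \in f :\ hd f.
  rewrite /tl; case: pickP => //= f0; move: f2.
  by rewrite (cardsD1 (hd f)) hf (eq_card0 f0).
move: (tf); rewrite in_setD1 eq_sym => /andP[nht tf']; split => //.
apply/eqP; rewrite eq_sym eqEcard f2 cards2 nht andbT.
by apply/fintype.subsetP => x /set2P[] ->.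
Qed.

(** [None] stands for an additional row, the unit vector of the root; with it the incidence matrix
    of a spanning tree is square. *)
Definition inc (o : option {set V}) (v : V) : int :=
  if o is Some f then (v == hd f)%:R - (v == tl f)%:R else (v == x0)%:R.

Lemma sum_inc (K : pzRingType) o (u : V -> K) :
  \sum_v (inc o v)%:~R * u v = if o is Some f then u (hd f) - u (tl f) else u x0.
Proof.
have d x : \sum_v (v == x)%:R * u v = u x.
  by rewrite (bigD1 x) //= eqxx mul1r big1 ?addr0 // => v /negPf ->; rewrite mul0r.
case: o => [f|] /=; last first.
  by under eq_bigr do rewrite mulrz_nat; exact: d.
under eq_bigr do rewrite mulrzBr !mulrz_nat mulrBl.
by rewrite sumrB !d.
Qed.

Definition inc_mx (r : nat) (g : 'I_r -> option {set V}) : 'M[int]_(r, #|V|) :=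
  \matrix_(i, j) inc (g i) (enum_val j).

Lemma adj_sym F : symmetric (adj F).
Proof. by move=> x y; rewrite /adj /= finset.setUC. Qed.

Lemma connect_adj_sym F : connect_sym (adj F).
Proof. exact: sym_connect_sym (adj_sym F). Qed.

Definition loopless F := {in F, forall f, #|f| = 2}.

Lemma adj_hd_tl F f : loopless F -> f \in F -> adj F (hd f) (tl f).
Proof. by move=> lF Ff; rewrite /adj /=; have [<-] := hd_tl (lF _ Ff). Qed.

Lemma adj_inc F x y : loopless F -> adj F x y ->
  exists2 f, f \in F & (forall v, (v == x)%:R - (v == y)%:R = inc (Some f) v) \/
                       (forall v, (v == x)%:R - (v == y)%:R = - inc (Some f) v).
Proof.
move=> lF Fxy; exists [set x; y]%SET => //.
have xy : x != y by have := lF _ Fxy; rewrite cards2; case: (x == y).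
have [E nht] := hd_tl (lF _ Fxy).
have : hd [set x; y]%SET \in [set x; y]%SET by rewrite {2}E set21.
have : tl [set x; y]%SET \in [set x; y]%SET by rewrite {2}E set22.
move: nht; rewrite /inc.
move: (hd _) (tl _) => h t ht /set2P[] ? /set2P[] ?; subst.
- by rewrite eqxx in ht.
- by right=> v; rewrite opprB.
- by left.
- by rewrite eqxx in ht.
Qed.

(** Adding to the root row the signed edge rows along a path from [x0] to [x] telescopes to the unit
    vector of [x]. Integer coefficients suffice, which later forces determinants of trees to be
    units. *)
Lemma connected_left_inverse F r (g : 'I_r -> option {set V}) :
  loopless F -> connected_edges F ->
  (exists i, g i = None) -> {in F, forall f, exists i, g i = Some f} ->
  exists D : 'M[int]_(#|V|, r), D *m inc_mx g = 1%:M.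
Proof.
move=> lF cF [i0 gi0] gF.
pose spn (u : 'rV[int]_#|V|) := exists D : 'rV_r, u = D *m inc_mx g.
have spn_row i : spn (\row_j inc (g i) (enum_val j)).
  exists (delta_mx 0 i); rewrite -rowE; apply/rowP => j; by rewrite !mxE.
have spnN u : spn u -> spn (- u) by move=> [D ->]; exists (- D); rewrite mulNmx.
have spnD u v : spn u -> spn v -> spn (u + v).
  by move=> [D ->] [D' ->]; exists (D + D'); rewrite mulmxDl.
pose dl x : 'rV[int]_#|V| := \row_j (enum_val j == x)%:R.
have spn_adj x y : adj F x y -> spn (dl x - dl y).
  move=> Fxy; have [f Ff Ef] := adj_inc lF Fxy; have [i gi] := gF f Ff.
  case: Ef => Ef; have := spn_row i; rewrite gi.
    by congr spn; apply/rowP => j; rewrite !mxE Ef.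
  by move/spnN; congr spn; apply/rowP => j; rewrite !mxE Ef.
have spn_dl x : spn (dl x).
  have /connectP[p pth ->] := cF x0 x.
  elim/last_ind: p pth => [|p y IHp] /=.
    by move=> _; have := spn_row i0; rewrite gi0.
  rewrite rcons_path last_rcons => /andP[/IHp sl] Fly.
  by rewrite -[dl y](addrNK (dl (last x0 p))); apply: spnD => //; apply: spn_adj; rewrite adj_sym.
have {}spn_dl i : exists D : 'rV_r, row i 1%:M = D *m inc_mx g.
  have [D ED] := spn_dl (enum_val i); exists D; rewrite -ED.
  by apply/rowP => j; rewrite !mxE (inj_eq enum_val_inj) eq_sym.
have [D ED] := boolp.choice spn_dl.
exists (\matrix_i D i); apply/row_matrixP => i.
by rewrite row_mul rowK -ED.
Qed.

Definition root_edges F : seq (option {set V}) := None :: map Some (enum F).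

Lemma size_root_edges F : size (root_edges F) = #|F|.+1.
Proof. by rewrite /= size_map -cardE. Qed.

Lemma mem_root_edges F o : (o \in root_edges F) = (if o is Some f then f \in F else true).
Proof.
rewrite inE; case: o => [f|] //=.
by rewrite mem_map ?mem_enum // => ? ? [].
Qed.

Lemma uniq_root_edges F : uniq (root_edges F).
Proof.
rewrite /= map_inj_uniq ?enum_uniq ?andbT; last by move=> ? ? [].
by apply/negP => /mapP[].
Qed.

Lemma connected_leq_card F : loopless F -> connected_edges F -> (#|V| <= #|F|.+1)%N.
Proof.
move=> lF cF; pose g (i : 'I_(#|F|.+1)) := nth None (root_edges F) i.
have gP o : o \in root_edges F -> exists i, g i = o.
  move=> Fo; have := Fo; rewrite -index_mem size_root_edges => lt.
  by exists (Ordinal lt); rewrite /g nth_index.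
have [D] := @connected_left_inverse F _ g lF cF (gP None (mem_head _ _))
  (fun f Ff => gP (Some f) (etrans (mem_root_edges F (Some f)) Ff)).
exact: mulmx1_min.
Qed.

(** With more rows than columns the rows satisfy a nontrivial linear relation, and any edge with
    nonzero coefficient in it lies on a cycle. *)
Lemma acyclic_geq_card F : loopless F -> acyclic_edges F -> (#|F|.+1 <= #|V|)%N.
Proof.
move=> lF aF; rewrite leqNgt; apply/negP => ltV.
pose g (i : 'I_(#|F|.+1)) := nth None (root_edges F) i.
have g_inj : injective g.
  move=> i j /eqP; rewrite nth_uniq ?uniq_root_edges // ?size_root_edges //.
  by move/eqP/val_inj.
pose C : 'M[rat]_(_, _) := map_mx intr (inc_mx g).
have : kermx C != 0.
  rewrite kermx_eq0 -row_leq_rank -ltnNge; apply: leq_ltn_trans ltV; exact: rank_leq_col.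
move=> /rowV0Pn[a /sub_kermxP aC a0].
have aCu (u : V -> rat) :
    \sum_i a 0 i * (if g i is Some f then u (hd f) - u (tl f) else u x0) = 0.
  under eq_bigr do rewrite -sum_inc mulr_sumr.
  rewrite exchange_big /= big1 // => v _.
  under eq_bigr do rewrite mulrA.
  have := congr1 (fun A : 'rV[rat]_#|V| => A 0 (enum_rank v)) aC.
  rewrite !mxE => E; rewrite -mulr_suml -[RHS](mul0r (u v)); congr (_ * _).
  by rewrite -[RHS]E; apply: eq_bigr => i _; rewrite !mxE enum_rankK.
(* Constant functions are killed by every edge row, which isolates the root coefficient. *)
have a_None i : g i = None -> a 0 i = 0.
  move=> gi; have := aCu (fun=> 1); rewrite (bigD1 i) //= gi mulr1 big1 ?addr0 // => j ji.
  case gj : (g j) => [f|]; first by rewrite subrr mulr0.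
  by case/eqP: ji; apply: g_inj; rewrite gi.
have /existsP[i ai] : [exists i, a 0 i != 0].
  apply: contraNT a0 => /existsPn a_0; apply/eqP/rowP => i; rewrite mxE.
  by apply/eqP; have := a_0 i; rewrite negbK.
case gi : (g i) => [f|]; last by rewrite a_None ?eqxx in ai.
have gF j f' : g j = Some f' -> f' \in F.
  by move=> gj; have := mem_root_edges F (Some f'); rewrite -gj mem_nth ?size_root_edges // gj.
have Ff := gF _ _ gi; have [Ef hf] := hd_tl (lF _ Ff).
set F' := F :\ f.
(* Otherwise the indicator of the component of [hd f] in [F'] takes equal values at the ends of
   every other edge, and the relation reduces to [a 0 i = 0]. *)
have /connectP[p pth lst] : connect (adj F') (hd f) (tl f).
  apply: contraT => nc.
  pose u v : rat := (connect (adj F') (hd f) v)%:R.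
  have := aCu u; rewrite (bigD1 i) //= gi big1 => [|j ji].
    by rewrite addr0 /u connect0 (negPf nc) /= subr0 mulr1 => /eqP; rewrite (negPf ai).
  case gj : (g j) => [f'|]; last by rewrite a_None ?mul0r.
  have F'f' : f' \in F'.
    rewrite in_setD1 (gF _ _ gj) andbT; apply: contraNneq ji => E.
    by apply/eqP/g_inj; rewrite gi gj E.
  have lF' : loopless F' by move=> f1; rewrite in_setD1 => /andP[_ /lF].
  have /same_connect_r E := connect1 (adj_hd_tl lF' F'f').
  by rewrite /u (E (connect_adj_sym _)) subrr mulr0.
move: lst; case/shortenP: pth => q pth uq _ lst.
(* A path with a single step would be the edge [f] itself, which [F'] lacks; hence at least three
   vertices. *)
have sz : (2 < size (hd f :: q))%N.
  case: q pth uq lst => [|y [|z q]] //= => [_ _ E|]; first by rewrite E eqxx in hf.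
  by rewrite andbT => + _ E; rewrite /adj /= -E -Ef setD11.
have /negP := aF _ sz; apply; rewrite /ucycleb uq andbT /= rcons_path -lst.
rewrite (sub_path _ pth) /=; last by move=> x y; rewrite /adj /= in_setD1 => /andP[].
by rewrite adj_sym adj_hd_tl.
Qed.

(** An edge of a cycle can be deleted without disconnecting the graph, which leaves fewer edges than
    [connected_leq_card] allows. *)
Lemma connected_acyclic F : loopless F -> connected_edges F -> #|F|.+1 = #|V| ->
  acyclic_edges F.
Proof.
move=> lF cF cardF p szp; apply/negP => /andP[].
case: p szp => [|x [|y [|z s]]] //= _.
rewrite rcons_path => /and3P[Fxy Fyz /andP[pz lz]] /and3P[].
rewrite !inE !negb_or => /and3P[xy xz xs] /andP[yz ys] uzs.
pose f := [set x; y]%SET; pose F' := F :\ f.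
have notf a b : a != y -> b != y -> [set a; b]%SET != f.
  move=> ay bY; apply/eqP => /setP /(_ y).
  by rewrite !inE eqxx orbT ![y == _]eq_sym (negPf ay) (negPf bY).
have F'yz : adj F' y z.
  rewrite /adj /= in_setD1 [_ \in F]Fyz andbT; apply/eqP => /setP /(_ x).
  by rewrite !inE eqxx (negPf xy) (negPf xz).
have F'p : path (adj F') z (rcons s x).
  apply: (@sub_in_path _ (predC1 y) (adj F)).
  - move=> a b; rewrite !inE => ay bY; rewrite /adj /= in_setD1 => ->.
    by rewrite notf.
  - rewrite /= eq_sym yz all_rcons /= xy /=.
    by apply/allP => a sa /=; apply: contraNneq ys => <-.
  - by rewrite rcons_path pz.
have cyx : connect (adj F') y x.
  apply/connectP; exists (z :: rcons s x); first by rewrite /= F'yz.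
  by rewrite /= last_rcons.
have lF' : loopless F' by move=> f1; rewrite in_setD1 => /andP[_ /lF].
have cF' : connected_edges F'.
  move=> a b; have := cF a b; apply: connect_sub => {}a {}b Fab.
  have [E|nE] := eqVneq [set a; b]%SET f; last by apply: connect1; rewrite /adj /= in_setD1 nE.
  have /set2P[Ea|Ea] : a \in f by rewrite -E set21.
    have /set2P[Eb|Eb] : b \in f by rewrite -E set22.
      by rewrite Ea Eb connect0.
    by rewrite Ea Eb connect_adj_sym.
  have /set2P[Eb|Eb] : b \in f by rewrite -E set22.
    by rewrite Ea Eb.
  by rewrite Ea Eb connect0.
have := connected_leq_card lF' cF'; rewrite -cardF.
by rewrite (cardsD1 f F) (Fxy : f \in F) ltnn.
Qed.

(** This replaces acyclicity by an edge count, the form that square incidence matrices detect. *)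
Lemma spanning_treeP (e : rel V) F : irreflexive e ->
  is_spanning_tree e F <->
  [/\ F \subset edges e, connected_edges F & #|F|.+1 = #|V|].
Proof.
move=> irr; have le : loopless (edges e).
  move=> f; rewrite inE => /existsP[x /existsP[y /andP[exy /eqP->]]].
  by rewrite cards2; case: eqVneq exy => // ->; rewrite irr.
split=> -[Fe cF h].
all: have lF : loopless F by move=> f /(fintype.subsetP Fe)/le.
all: split => //.
  by apply/eqP; rewrite eqn_leq acyclic_geq_card // connected_leq_card.
exact: connected_acyclic.
Qed.

End IncidenceMatrix.

(** * The transfer current theorem *)

(** The adjugate serves in place of an inverse, so the argument applies over the integers. *)
Lemma det_eq0_of_ker (K : idomainType) n (A : 'M[K]_n) (u : 'cV[K]_n) :
  u != 0 -> A *m u = 0 -> \det A = 0.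
Proof.
move=> u0 Au; apply/eqP; move: u0; apply: contraNT => dA.
have : \det A *: u = 0 by rewrite -mul_scalar_mx -mul_adj_mx -mulmxA Au mulmx0.
move=> /colP E; apply/eqP/colP => i; move/eqP: (E i).
by rewrite !mxE mulf_eq0 (negPf dA) => /eqP.
Qed.

Lemma sum_enum_val (V : finType) (K : nmodType) (u : V -> K) :
  \sum_(i < #|V|) u (enum_val i) = \sum_v u v.
Proof. by rewrite -(big_enum_val u). Qed.

Section TreeDeterminant.
Variables (V : finType) (x0 : V) (e : rel V).
Hypothesis e_irr : irreflexive e.
Local Notation inc := (inc x0).
Local Notation N := #|V|.

Definition img (f : {ffun 'I_N -> option {set V}}) : {set {set V}} :=
  [set h | Some h \in codom f]%SET.

(** The weight 0 off the graph lets the sums of Cauchy-Binet run over the whole type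
    [option {set V}]. *)
Definition wt (K : pzRingType) (w : {set V} -> K) (o : option {set V}) : K :=
  if o is Some f then (if f \in edges e then w f else 0) else 1.

Lemma perm_img (f : {ffun 'I_N -> option {set V}}) :
  injectiveb f -> None \in codom f -> perm_eq (codom f) (root_edges (img f)).
Proof.
move=> injf Nf; apply: uniq_perm => //; first exact: uniq_root_edges.
by case=> [h|]; rewrite mem_root_edges ?inE // Nf.
Qed.

Lemma edges_loopless (F : {set {set V}}) : F \subset edges e -> loopless F.
Proof.
move=> /fintype.subsetP Fe f /Fe; rewrite inE => /existsP[x /existsP[y /andP[exy /eqP->]]].
by rewrite cards2; case: eqVneq exy => // ->; rewrite e_irr.
Qed.

(** The left inverse is integral, so the determinant divides 1. *)
Lemma det_inc_tree (f : {ffun 'I_N -> option {set V}}) :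
  injectiveb f -> None \in codom f -> img f \in spanning_trees e ->
  \det (inc_mx x0 f) ^+ 2 = 1.
Proof.
move=> injf /codomP[i Ni]; rewrite inE => /asboolP/(spanning_treeP x0 _ e_irr)[Fe cF _].
have [||D DC] := @connected_left_inverse _ x0 (img f) _ f (edges_loopless Fe) cF.
- by exists i.
- by move=> h; rewrite inE => /codomP[j ->]; exists j.
have dd : \det D * \det (inc_mx x0 f) = 1 by rewrite -det_mulmx DC det1.
have : `|\det (inc_mx x0 f)|%N = 1%N.
  apply/eqP; rewrite -dvdn1; apply/dvdnP; exists `|\det D|%N.
  by rewrite -abszM dd.
by move=> E; rewrite [\det _]intEsign E mulr1 sqrr_sign.
Qed.

(** A repeated value gives two equal rows. Without the root, the constant function 1 is in the
    kernel. With it, the number of edges is already that of a tree, so some vertex is out of reach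
    of [x0], and the indicator of the unreachable vertices is in the kernel. *)
Lemma det_inc_nontree (f : {ffun 'I_N -> option {set V}}) : img f \subset edges e ->
  ~~ [&& injectiveb f, None \in codom f & img f \in spanning_trees e] ->
  \det (inc_mx x0 f) = 0.
Proof.
move=> Fe; case: (boolP (injectiveb f)) => [injf|/injectivePn[i [j ij fij]] _]; last first.
  by apply: (determinant_alternate ij) => k; rewrite !mxE fij.
have ker (u : V -> int) : (exists v, u v != 0) ->
    (forall i, (if f i is Some h then u (hd x0 h) - u (tl x0 h) else u x0) = 0) ->
    \det (inc_mx x0 f) = 0.
  move=> [v uv] fu; apply: (@det_eq0_of_ker _ _ _ (\col_j u (enum_val j))).
    by apply/eqP => /colP /(_ (enum_rank v)) /eqP; rewrite !mxE enum_rankK (negPf uv).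
  apply/colP => i; rewrite !mxE -[RHS](fu i) -sum_inc.
  by rewrite -[RHS]sum_enum_val; apply: eq_bigr => j _; rewrite !mxE intz.
case: (boolP (None \in codom f)) => [Nf|Nf _] /=; last first.
  apply: (ker (fun=> 1)); first by exists x0.
  move=> i; case fi : (f i) => [h|]; first exact: subrr.
  by rewrite -fi codom_f in Nf.
have sz : #|img f|.+1 = N.
  by rewrite -size_root_edges -(perm_size (perm_img injf Nf)) size_codom card_ord.
move=> nT; have /existsP[v ncv] : [exists v, ~~ connect (adj (img f)) x0 v].
  apply: contraNT nT => /existsPn c; rewrite inE; apply/asboolP/(spanning_treeP x0 _ e_irr).
  split=> // x y; apply: (@connect_trans _ _ x0).
    by rewrite connect_adj_sym; have := c x; rewrite negbK.
  by have := c y; rewrite negbK.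
apply: (ker (fun v => (~~ connect (adj (img f)) x0 v)%:R)); first by exists v; rewrite ncv.
move=> i; case fi : (f i) => [h|]; last by rewrite connect0.
have Fh : h \in img f by rewrite inE -fi codom_f.
have /same_connect_r E := connect1 (adj_hd_tl x0 (edges_loopless Fe) Fh).
by rewrite (E (@connect_adj_sym _ _)) subrr.
Qed.

Lemma prod_wt_img (K : comPzRingType) (w : {set V} -> K) (f : {ffun 'I_N -> option {set V}}) :
  injectiveb f -> None \in codom f -> img f \subset edges e ->
  \prod_i wt w (f i) = \prod_(h in img f) w h.
Proof.
move=> injf Nf Fe.
transitivity (\prod_(o <- codom f) wt w o).
  by rewrite codomE big_map big_enum.
rewrite (perm_big _ (perm_img injf Nf)) /= big_cons mul1r big_map big_enum /=.
by apply: eq_bigr => h /(fintype.subsetP Fe) eh; rewrite eh.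
Qed.

(** Such an [f] is an enumeration of the N elements of [root_edges F]; the count cancels the
    factorial in [gram_det]. *)
Lemma card_img (F : {set {set V}}) : F \in spanning_trees e ->
  #|[pred f : {ffun 'I_N -> option {set V}} |
     [&& injectiveb f, None \in codom f & img f == F]]| = N`!.
Proof.
rewrite inE => /asboolP/(spanning_treeP x0 _ e_irr)[_ _ cF].
have cR : #|root_edges F| = N by rewrite (card_uniqP (uniq_root_edges F)) size_root_edges.
transitivity #|[set f : {ffun 'I_N -> option {set V}} in
                 ffun_on [in root_edges F] | injectiveb f]|; last first.
  by rewrite card_inj_ffuns_on cR card_ord ffactnn.
apply: eq_card => f; rewrite !inE.
apply/and3P/andP => [[injf Nf /eqP<-]|[]].
  split=> //; apply/ffun_onP => i; rewrite -(perm_mem (perm_img injf Nf)); exact: codom_f.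
move=> /ffun_onP fF injf.
have [] := @uniq_min_size _ (codom f) (root_edges F) injf.
- by move=> o /codomP[i ->]; exact: fF.
- by rewrite size_root_edges size_codom card_ord cF.
move=> _ E; split=> //.
by apply/eqP/setP => h; rewrite inE E mem_root_edges.
Qed.

(* Cauchy-Binet for [e_x0 | b_f, f an edge]: a nonzero N x N minor selects the
   root column and the edges of a connected graph, hence a spanning tree, and
   is then a unit of the integers. *)
Theorem tree_determinant (K : idomainType) (w : {set V} -> K) : N`!%:R != 0 :> K ->
  \det (\matrix_(i < N, j < N) \sum_o
     wt w o * (inc o (enum_val i))%:~R * (inc o (enum_val j))%:~R) =
  \sum_(F in spanning_trees e) \prod_(f in F) w f.
Proof.
move=> N0; apply: (mulfI N0).
rewrite (gram_det (wt w) (fun o i => (inc o (enum_val i))%:~R : K)).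
have detE (f : {ffun 'I_N -> option {set V}}) :
    \det (\matrix_(i, j) (inc (f i) (enum_val j))%:~R) = (\det (inc_mx x0 f))%:~R :> K.
  by rewrite -det_map_mx; congr determinant; apply/matrixP => i j; rewrite !mxE.
under eq_bigr do rewrite detE.
pose C (f : {ffun 'I_N -> option {set V}}) :=
  [&& injectiveb f, None \in codom f & img f \in spanning_trees e].
rewrite (bigID C) /= [X in _ + X]big1 ?addr0; last first.
  move=> f nC; have [Fe|/fintype.subsetPn[h]] := boolP (img f \subset edges e).
    by rewrite (det_inc_nontree Fe nC) expr0n mulr0.
  rewrite inE => /codomP[i fi] /negPf he.
  by rewrite (bigD1 i) //= -fi /= he !mul0r.
rewrite (partition_big img (mem (spanning_trees e))) /=; last by move=> f /and3P[].
rewrite mulr_sumr; apply: eq_bigr => F TF.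
rewrite -(card_img TF) mulr_natl -sumr_const.
apply: eq_big => [f|f /andP[/and3P[injf Nf Tf] /eqP<-]].
  by rewrite !inE /C -!andbA; case: eqVneq => [->|]; rewrite ?andbF // TF.
move: (Tf); rewrite inE => /asboolP[Fe _ _].
by rewrite prod_wt_img // -rmorphXn det_inc_tree // mulr1.
Qed.

Lemma sum_wt (K : pzRingType) (w : {set V} -> K) (u : option {set V} -> K) :
  \sum_o wt w o * u o = u None + \sum_(f in edges e) w f * u (Some f).
Proof.
rewrite (bigD1 None) //= mul1r; congr (_ + _).
rewrite (reindex_omap Some id) /=; last by case.
under eq_bigl do rewrite eqxx.
rewrite [RHS]big_mkcond /=; apply: eq_bigr => f _.
by case: ifP; rewrite ?mul0r.
Qed.

Section TransferCurrent.
Variables (R : numFieldType) (X : V -> V -> R).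
(** An edge-by-edge form of the condition that [X] inverts the Laplacian with 1 added at the
    diagonal entry of [x0]. *)
Hypothesis X_inv : forall u v, (u == x0)%:R * X x0 v +
  \sum_(f in edges e) (inc (Some f) u)%:~R * (X (hd x0 f) v - X (tl x0 f) v) = (u == v)%:R.

Local Notation M w := (\matrix_(i < N, j < N) \sum_o
  wt w o * (inc o (enum_val i))%:~R * (inc o (enum_val j))%:~R).
Local Notation Xm := (\matrix_(i < N, j < N) X (enum_val i) (enum_val j)).

(** The bilinear form b_f^T X b_g. It takes differences in both arguments, so a term of [X] that
    depends on one argument alone drops out. *)
Definition transfer (f g : {set V}) : R :=
  X (hd x0 f) (hd x0 g) - X (hd x0 f) (tl x0 g)
  - (X (tl x0 f) (hd x0 g) - X (tl x0 f) (tl x0 g)).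

Lemma laplacian_mulX : (M (fun=> 1)) *m Xm = 1%:M.
Proof.
apply/matrixP => i j; rewrite !mxE -(inj_eq enum_val_inj) -X_inv.
under eq_bigr do rewrite !mxE mulr_suml.
rewrite exchange_big /=.
under eq_bigr => o _.
  under eq_bigr => k _ do rewrite -mulrA.
  rewrite -mulr_sumr (sum_enum_val (fun v => (inc o v)%:~R * X v (enum_val j))).
  rewrite (sum_inc x0 o (X^~ (enum_val j))) -mulrA.
  over.
rewrite sum_wt /= mulrz_nat; congr (_ + _).
by apply: eq_bigr => f _; rewrite mul1r.
Qed.

Lemma num_trees : #|spanning_trees e|%:R = \det (M (fun=> 1 : R)).
Proof.
rewrite tree_determinant ?pnatr_eq0 -?lt0n ?fact_gt0 //.
under eq_bigr do rewrite big1_eq.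
by rewrite sumr_const.
Qed.

(** The number of trees is the determinant of an invertible matrix, so no tree has to be
    exhibited. *)
Lemma trees_neq0 : #|spanning_trees e|%:R != 0 :> R.
Proof.
apply/eqP => E; have := congr1 determinant laplacian_mulX.
by rewrite det_mulmx -num_trees E mul0r det1 => /esym/eqP; rewrite oner_eq0.
Qed.

(** Weighting the chosen edges by ['X] perturbs the grounded Laplacian by [('X - 1)] times a matrix
    that factors through dimension r. After division by the Laplacian, [det_one_add_mulC] leaves an
    r x r determinant; the coefficients of degree r are then compared. *)
Theorem transfer_current r (g : 'I_r -> {set V}) : injective g ->
  (forall i, g i \in edges e) ->
  #|[set F in spanning_trees e | [forall i, g i \in F]]|%:R =
  #|spanning_trees e|%:R * \det (\matrix_(i, j) transfer (g i) (g j)).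
Proof.
move=> injg ge.
pose w (f : {set V}) : {poly R} := if f \in codom g then 'X else 1.
have := @tree_determinant _ w _.
have -> : N`!%:R != 0 :> {poly R}.
  by rewrite -polyC_natr polyC_eq0 pnatr_eq0 -lt0n fact_gt0.
move=> /(_ isT) /(congr1 (fun p : {poly R} => p`_r)).
pose B : 'M[R]_(r, N) := map_mx intr (inc_mx x0 (fun i => Some (g i))).
have EM : M w = map_mx polyC (M (fun=> 1 : R)) + ('X - 1) *: map_mx polyC (B^T *m B).
  apply/matrixP => i j; rewrite !mxE !raddf_sum /=.
  under eq_bigr do rewrite -mulrA.
  under [in RHS]eq_bigr do rewrite -mulrA.
  rewrite (sum_wt w (fun o => (inc o (enum_val i))%:~R * (inc o (enum_val j))%:~R)).
  have Esum := sum_wt (fun=> 1) (fun o => ((inc o (enum_val i))%:~R * (inc o (enum_val j))%:~R) : R).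
  rewrite -raddf_sum Esum /= polyCD /= -addrA; congr (_ + _).
    by rewrite rmorphM /= !rmorph_int.
  rewrite mulr_sumr rmorph_sum /=.
  rewrite (bigID [in codom g]) [in RHS](bigID [in codom g]) /= addrAC.
  congr (_ + _); last first.
    apply: eq_bigr => f /andP[_ /negPf nf].
    by rewrite /w nf !mul1r rmorphM /= !rmorph_int.
  have Eg (u : {set V} -> {poly R}) :
      \sum_(f in edges e | f \in codom g) u f = \sum_k u (g k).
    transitivity (\sum_(f <- codom g) u f); last by rewrite codomE big_map big_enum.
    rewrite -big_filter; apply: perm_big; apply: uniq_perm.
    - by rewrite filter_uniq // index_enum_uniq.
    - by rewrite codomE map_inj_uniq ?enum_uniq.
    move=> f; rewrite mem_filter mem_index_enum andbT.
    by apply: andb_idl => /codomP[k ->].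
  rewrite !Eg -big_split /=; apply: eq_bigr => k _.
  have Ez z : (z%:~R : R)%:P = z%:~R :> {poly R} by rewrite rmorph_int.
  rewrite /w codom_f !mxE mul1r -!intrM !Ez.
  by rewrite [('X - 1) * _]mulrBl mul1r addrC subrK.
rewrite EM.
have -> : map_mx polyC (M (fun=> 1 : R)) + ('X - 1) *: map_mx polyC (B^T *m B) =
    map_mx polyC (M (fun=> 1 : R)) *m
    (1%:M + (('X - 1) *: map_mx polyC (Xm *m B^T)) *m map_mx polyC B).
  rewrite mulmxDr mulmx1; congr (_ + _).
  by rewrite -scalemxAl -scalemxAr -!map_mxM !mulmxA laplacian_mulX mul1mx.
rewrite det_mulmx det_one_add_mulC -scalemxAr -map_mxM det_map_mx coefCM -num_trees.
(* Regrouped as constant plus ['X] times a matrix, so that [coef_det_linear] discards the constant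
   part. *)
have -> : 1%:M + ('X - 1) *: map_mx polyC (B *m (Xm *m B^T)) =
    map_mx polyC (1%:M - B *m (Xm *m B^T)) + 'X *: map_mx polyC (B *m (Xm *m B^T)).
  by rewrite map_mxB map_mx1 scalerBl scale1r addrA addrAC.
rewrite coef_det_linear => E.
have -> : \matrix_(i, j) transfer (g i) (g j) = B *m (Xm *m B^T).
  apply/matrixP => i j; rewrite !mxE.
  have E2 k : (Xm *m B^T) k j = X (enum_val k) (hd x0 (g j)) - X (enum_val k) (tl x0 (g j)).
    rewrite -(sum_inc x0 (Some (g j)) (X (enum_val k))) -[RHS]sum_enum_val mxE.
    by apply: eq_bigr => l _; rewrite !mxE mulrC.
  under eq_bigr => k _ do rewrite E2 !mxE.
  rewrite (sum_enum_val (fun v => (inc (Some (g i)) v)%:~R * (X v (hd x0 (g j)) - X v (tl x0 (g j))))).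
  by rewrite (sum_inc x0 (Some (g i)) (fun v => X v (hd x0 (g j)) - X v (tl x0 (g j)))).
rewrite {}E coef_sum -sum1_card natr_sum [LHS](_ : _ =
  \sum_(F in spanning_trees e) [forall i, g i \in F]%:R); last first.
  rewrite [LHS]big_mkcond [RHS]big_mkcond /=; apply: eq_bigr => F _.
  by rewrite inE; case: (F \in spanning_trees e) => //=; case: [forall _, _].
apply: eq_bigr => F _.
have -> : \prod_(f in F) w f = 'X^#|F :&: [set f in codom g]|.
  rewrite -prodr_const big_mkcond [RHS]big_mkcond /=; apply: eq_bigr => f _.
  by rewrite !inE /w; case: (f \in F).
rewrite coefXn; congr (nat_of_bool _)%:R.
set G := [set f in codom g]%SET.
have cg : #|G| = r.
  have ucg : uniq (codom g) by rewrite codomE map_inj_uniq ?enum_uniq.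
  by rewrite cardsE (card_uniqP ucg) size_codom card_ord.
(* The exponent of [F] is the number of chosen edges in it, and it reaches r only when all of them
   are there. *)
have -> : (r == #|F :&: G|) = (G \subset F).
  apply/eqP/idP => [E|/finset.setIidPr ->]; last by rewrite cg.
  by apply/finset.setIidPr/eqP; rewrite eqEcard finset.subsetIr cg E leqnn.
apply/forallP/fintype.subsetP => [gF f|GF i]; first by rewrite inE => /codomP[i ->].
by apply: GF; rewrite inE codom_f.
Qed.

End TransferCurrent.
End TreeDeterminant.

(** * Factorial moments of the number of common edges *)

Section FactorialMoment.
Variables (V : finType) (x0 : V) (e : rel V).
Hypothesis e_irr : irreflexive e.
Variables (R : numFieldType) (X : V -> V -> R).
Hypothesis X_inv : forall u v, (u == x0)%:R * X x0 v +
  \sum_(f in edges e) (inc x0 (Some f) u)%:~R * (X (hd x0 f) v - X (tl x0 f) v) = (u == v)%:R.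

(** Double counting: the binomial counts the r-sets [D] inside both [F] and [F'], and for a fixed
    [D] the two trees are chosen separately, hence the square. *)
Lemma sum_bin_common (T : finType) (S : {set {set T}}) (E : {set T}) r :
  (forall F, F \in S -> F \subset E) ->
  (\sum_(F in S) \sum_(F' in S) 'C(#|F :&: F'|, r))%N =
  (\sum_(D : {set T} | (D \subset E) && (#|D| == r)) #|[set F in S | D \subset F]| ^ 2)%N.
Proof.
move=> SE.
under eq_bigr => F SF do under eq_bigr => F' SF' do rewrite -cards_draws -sum1_card.
pose b (F F' D : {set T}) := (D \subset F) && (D \subset F').
transitivity (\sum_(F in S) \sum_(F' in S)
    \sum_(D : {set T} | (D \subset E) && (#|D| == r)) b F F' D)%N.
  apply: eq_bigr => F SF; apply: eq_bigr => F' SF'.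
  rewrite [LHS]big_mkcond [RHS]big_mkcond /=; apply: eq_bigr => D _.
  rewrite inE finset.subsetI /b.
  have [DF|] := boolP (D \subset F) => /=; last by case: ifP.
  rewrite (fintype.subset_trans DF (SE _ SF)) /=.
  by case: (D \subset F'); case: (#|D| == r).
under eq_bigr do rewrite exchange_big.
rewrite exchange_big; apply: eq_bigr => D _.
have cD : #|[set F in S | D \subset F]%SET| = (\sum_(F in S) (D \subset F))%N.
  rewrite -sum1_card [LHS]big_mkcond [RHS]big_mkcond; apply: eq_bigr => F _.
  by rewrite inE; case: (F \in S) => //=; case: (D \subset F).
rewrite -mulnn cD big_distrl /=; apply: eq_bigr => F _.
by rewrite big_distrr /=; apply: eq_bigr => F' _; rewrite mulnb.
Qed.

Lemma card_inj_onto (T : finType) r (D : {set T}) : #|D| = r ->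
  #|[pred g : {ffun 'I_r -> T} | injectiveb g & [set g i | i : 'I_r]%SET == D]| = r`!.
Proof.
move=> cD.
transitivity #|[set g : {ffun 'I_r -> T} in ffun_on [in D] | injectiveb g]|; last first.
  by rewrite card_inj_ffuns_on cD card_ord ffactnn.
apply: eq_card => g; rewrite !inE.
apply/andP/andP => [[injg /eqP<-]|[/ffun_onP gD injg]]; split=> //.
  by apply/ffun_onP => i; apply/imsetP; exists i.
rewrite eqEcard (card_imset _ (injectiveP _ injg)) card_ord cD leqnn andbT.
by apply/fintype.subsetP => _ /imsetP[i _ ->]; exact: gD.
Qed.

(** Each r-set of edges has r! enumerations, which absorbs the factorial. Non-injective [g] have two
    equal rows and contribute 0, so the sum can run over a full product of copies of [edges e]. *)
Theorem factorial_moment r :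
  r`!%:R * \sum_(F in spanning_trees e) \sum_(F' in spanning_trees e)
     ('C(#|F :&: F'|, r))%:R = #|spanning_trees e|%:R ^+ 2 *
  \sum_(g : {ffun 'I_r -> {set V}} | g \in ffun_on [in edges e])
     (\det (\matrix_(i, j) transfer x0 X (g i) (g j))) ^+ 2 :> R.
Proof.
have SE F : F \in spanning_trees e -> F \subset edges e.
  by rewrite inE => /asboolP[].
under eq_bigr do rewrite -natr_sum.
rewrite -natr_sum (sum_bin_common r SE) natr_sum mulr_sumr.
rewrite (bigID (fun g : {ffun 'I_r -> {set V}} => injectiveb g)) /=.
rewrite [X in _ * (_ + X)]big1 ?addr0; last first.
  move=> g /andP[_ /injectivePn[i [j ij gij]]].
  rewrite (determinant_alternate ij) ?expr0n // => k.
  by rewrite !mxE gij.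
rewrite (partition_big (fun g : {ffun 'I_r -> {set V}} => [set g i | i : 'I_r]%SET)
  (fun D : {set {set V}} => (D \subset edges e) && (#|D| == r))) /=; last first.
  move=> g /andP[/ffun_onP gE /injectiveP injg].
  rewrite card_imset // card_ord eqxx andbT.
  by apply/fintype.subsetP => _ /imsetP[i _ ->]; exact: gE.
rewrite mulr_sumr; apply: eq_bigr => D /andP[DE /eqP cD].
rewrite -(card_inj_onto cD) mulr_natl -sumr_const mulr_sumr; apply: eq_big => g.
  rewrite inE andbC; case: eqVneq => [gD|]; rewrite ?andbF //= andbT; symmetry; apply: andb_idl => injg.
  by apply/ffun_onP => i; apply: (fintype.subsetP DE); rewrite -gD; apply/imsetP; exists i.
rewrite inE => /andP[/injectiveP injg /eqP gD].
have gE i : g i \in edges e.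
  by apply: (fintype.subsetP DE); rewrite -gD; apply/imsetP; exists i.
rewrite -exprMn -(transfer_current e_irr X_inv injg gE) natrX; congr (_%:R ^+ 2).
apply: eq_card => F; rewrite !inE; congr (_ && _).
rewrite -gD; apply/fintype.subsetP/forallP => [DF i|gF _ /imsetP[i _ ->]]; last exact: gF.
by apply: DF; apply/imsetP; exists i.
Qed.

End FactorialMoment.

(** * Sums of squared determinants over tuples *)

Lemma sum_ffun_pair (R : comPzSemiRingType) (T : finType) (A : {set T}) r (k : T -> T -> R)
    (i j : 'I_r) : i != j ->
  \sum_(g : {ffun 'I_r -> T} | g \in ffun_on [in A]) k (g i) (g j) =
  #|A|%:R ^+ r.-2 * \sum_(a in A) \sum_(b in A) k a b.
Proof.
move=> ij; have ji : j != i by rewrite eq_sym.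
(* Kronecker deltas at [i] and [j] turn the summand into a product over coordinates, so that the sum
   over [g] factors. The other [r.-2] coordinates are free. *)
pose F a b (l : 'I_r) (x : T) : R :=
  if l == i then (x == a)%:R else if l == j then (x == b)%:R else 1.
have delta (a : T) (u : T -> R) : a \in A -> \sum_(x in A) (a == x)%:R * u x = u a.
  move=> Aa; rewrite (bigD1 a) //= eqxx mul1r big1 ?addr0 // => x /andP[_].
  by rewrite eq_sym => /negPf ->; rewrite mul0r.
have FE a b (g : {ffun 'I_r -> T}) :
    \prod_l F a b l (g l) = (g i == a)%:R * (g j == b)%:R.
  rewrite (bigD1 i) //= (bigD1 j ji) /= big1 ?mulr1 /F ?eqxx.
    by rewrite (negPf ji).
  by move=> l /andP[/negPf-> /negPf->].
transitivity (\sum_(g : {ffun 'I_r -> T} | g \in ffun_on [in A])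
   \sum_(a in A) \sum_(b in A) k a b * \prod_l F a b l (g l)).
  apply: eq_bigr => g /ffun_onP gA.
  rewrite -[LHS](delta (g i) (fun a => k a (g j)) (gA i)); apply: eq_bigr => a Aa.
  rewrite -(delta (g j) (k a) (gA j)) mulr_sumr; apply: eq_bigr => b Ab.
  by rewrite FE mulrA mulrC.
rewrite exchange_big mulr_sumr; apply: eq_bigr => a Aa.
rewrite exchange_big mulr_sumr; apply: eq_bigr => b Ab.
rewrite -mulr_sumr mulrC -bigA_distr_big; congr (_ * _).
rewrite (bigD1 i) //= (bigD1 j ji) /=.
rewrite [X in X * _](_ : _ = 1); last first.
  rewrite -[RHS](delta a (fun=> 1)) //; apply: eq_bigr => x _.
  by rewrite /F eqxx eq_sym mulr1.
rewrite [X in _ * (X * _)](_ : _ = 1); last first.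
  rewrite -[RHS](delta b (fun=> 1)) //; apply: eq_bigr => x _.
  by rewrite /F (negPf ji) eqxx [x == b]eq_sym mulr1.
rewrite !mul1r (eq_bigr (fun=> #|A|%:R)); last first.
  move=> l /andP[/negPf li /negPf lj]; rewrite -sumr_const; apply: eq_bigr => x _.
  by rewrite /F li lj.
rewrite prodr_const; congr (_ ^+ _).
have -> : #|(fun l : 'I_r => (l != i) && (l != j))| = #|[predC [set i; j]%SET]|.
  by apply: eq_card => l; rewrite !inE negb_or.
apply/eqP; rewrite -(eqn_add2l 2).
have c2 : #|[set i; j]%SET| = 2%N by rewrite cards2 ij.
rewrite -{1}c2 cardC card_ord; case: (r) i j ij {F ji FE c2} => [|[|q]] //; first by case.
by move=> i j; rewrite !ord1.
Qed.

Section DetSquares.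
Variables (R : realFieldType) (T : finType) (A : {set T}) (K : T -> T -> R) (N C : R).
Hypotheses (N0 : 0 < N) (C0 : 0 <= C).
Hypothesis K_le : {in A &, forall a b, `|K a b| <= C / N}.
Hypothesis sum_K_le : \sum_(a in A) \sum_(b in A) `|K a b| <= C * N ^+ 2.
Hypothesis card_le : #|A|%:R <= N ^+ 2.

(* Every permutation but the identity moves some index i, and then contributes
   at most (C/N)^(r-1) |K (g i) (g (s i))|; summing the last factor over g gives
   the extra power of 1/N. *)
Lemma sum_det_sqr_approx r :
  `|\sum_(g : {ffun 'I_r -> T} | g \in ffun_on [in A])
      (\det (\matrix_(i, j) K (g i) (g j))) ^+ 2 - (\sum_(a in A) K a a ^+ 2) ^+ r|
  <= (r`!.+1)%:R * r`!%:R * C ^+ (2 * r) / N.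
Proof.
have CN0 : 0 <= C / N by rewrite divr_ge0 // ltW.
have prod_le (g : {ffun 'I_r -> T}) (s : 'S_r) (P : pred 'I_r) : g \in ffun_on [in A] ->
    \prod_(i | P i) `|K (g i) (g (s i))| <= (C / N) ^+ #|P|.
  move=> /ffun_onP gA; rewrite -prodr_const; apply: ler_prod => i _.
  by rewrite normr_ge0 K_le.
pose D (g : {ffun 'I_r -> T}) := \det (\matrix_(i, j) K (g i) (g j)).
pose P (g : {ffun 'I_r -> T}) := \prod_i K (g i) (g i).
have DE g : D g = \sum_(s : 'S_r) (-1) ^+ s * \prod_i K (g i) (g (s i)).
  by apply: eq_bigr => s _; congr (_ * _); apply: eq_bigr => i _; rewrite mxE.
have card_S : #|{: 'S_r}| = r`! by rewrite card_Sn.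
have D_le g : g \in ffun_on [in A] -> `|D g| <= r`!%:R * (C / N) ^+ r.
  move=> gA; rewrite DE; apply: le_trans (ler_norm_sum _ _ _) _.
  rewrite -card_S mulr_natl -sumr_const; apply: ler_sum => s _.
  rewrite normrM normr_sign mul1r normr_prod.
  by apply: le_trans (prod_le g s predT gA) _; rewrite card_ord.
have P_le g : g \in ffun_on [in A] -> `|P g| <= (C / N) ^+ r.
  move=> gA; rewrite normr_prod; have := prod_le g 1%g predT gA.
  by rewrite card_ord; under eq_bigr do rewrite perm1.
have DP g : `|D g - P g| <= \sum_(s : 'S_r | s != 1%g) \prod_i `|K (g i) (g (s i))|.
  rewrite DE (bigD1 1%g) //= odd_perm1 mul1r.
  under eq_bigr do rewrite perm1.
  rewrite -/(P g) addrAC subrr add0r; apply: le_trans (ler_norm_sum _ _ _) _.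
  by apply: ler_sum => s _; rewrite normrM normr_sign mul1r normr_prod.
have sum_s (s : 'S_r) : s != 1%g ->
    \sum_(g : {ffun 'I_r -> T} | g \in ffun_on [in A]) \prod_i `|K (g i) (g (s i))|
    <= (C / N) ^+ r.-1 * (C * N ^+ 2 * (N ^+ 2) ^+ r.-2).
  move=> s1; have /existsP[i si] : [exists i, s i != i].
    apply: contraNT s1 => /existsPn si; apply/eqP/permP => i; rewrite perm1.
    by apply/eqP; have := si i; rewrite negbK.
  apply: (@le_trans _ _ (\sum_(g : {ffun 'I_r -> T} | g \in ffun_on [in A])
      (C / N) ^+ r.-1 * `|K (g i) (g (s i))|)).
    apply: ler_sum => g gA; rewrite (bigD1 i) //= mulrC ler_wpM2r //.
    apply: le_trans (prod_le g s _ gA) _.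
    by rewrite cardC1 card_ord.
  rewrite -mulr_sumr ler_wpM2l ?exprn_ge0 //.
  rewrite (sum_ffun_pair A (fun a b => `|K a b|)) 1?eq_sym // mulrC ler_pM //.
  - by rewrite !sumr_ge0 // => a _; rewrite sumr_ge0.
  - by rewrite lerXn2r // nnegrE ?sqr_ge0.
have -> : (\sum_(a in A) K a a ^+ 2) ^+ r =
    \sum_(g : {ffun 'I_r -> T} | g \in ffun_on [in A]) P g ^+ 2.
  rewrite -[in LHS](card_ord r) -prodr_const bigA_distr_big; apply: eq_bigr => g _.
  by rewrite /P -prodrXl.
rewrite -sumrB; apply: le_trans (ler_norm_sum _ _ _) _.
apply: (@le_trans _ _ (\sum_(g : {ffun 'I_r -> T} | g \in ffun_on [in A])
   (r`!.+1)%:R * (C / N) ^+ r *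
     \sum_(s : 'S_r | s != 1%g) \prod_i `|K (g i) (g (s i))|)).
  (* The difference of squares is split as (D - P)(D + P). The factor r! + 1 bounds the second
     factor: r! terms for [D] and one for [P]. *)
  apply: ler_sum => g gA; rewrite subr_sqr normrM mulrC ler_pM // ?DP //.
  apply: le_trans (ler_normD _ _) _.
  by rewrite -natr1 mulrDl mul1r lerD ?D_le ?P_le.
rewrite -mulr_sumr exchange_big /=.
have := @ler_sum _ _ (index_enum _) (fun s : 'S_r => s != 1%g) _ _ sum_s.
rewrite sumr_const -[leRHS]mulr_natl => sum_le.
have cf : 0 <= r`!.+1%:R * (C / N) ^+ r by rewrite mulr_ge0 ?exprn_ge0.
apply: le_trans (ler_wpM2l cf sum_le) _.
(* For r at most 1 there is no permutation but the identity; the power count below needs r at least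
   2, where [r.-2] is not truncated. *)
have [r1|r2] := leqP r 1.
  rewrite eq_card0 => [|s].
    rewrite mul0r mulr0; apply: divr_ge0; last exact: ltW.
    by rewrite mulr_ge0 ?exprn_ge0 // mulr_ge0.
  apply/negbTE; rewrite negbK; apply/eqP/permP => i; rewrite perm1.
  by case: (r) r1 i (s i) => [|[|?]] // _ i j; rewrite ?ord1 //; case: i.
set n := #|_|; set B := (X in _ * (_ * X)).
have nr : n%:R <= r`!%:R :> R by rewrite ler_nat -card_S max_card.
(* The exponents of N add up to -r - (r - 1) + 2 + 2(r - 2) = -1. *)
have E : (C / N) ^+ r * B = C ^+ (2 * r) / N.
  rewrite /B; have [q ->] : exists q, r = q.+2 by exists r.-2; case: (r) r2 => [|[|]].
  have -> : (2 * q.+2 = q + q + 4)%N by lia.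
  rewrite /= -exprM !expr_div_n mul2n -addnn.
  rewrite !(exprD, exprS, expr0).
  have : N ^+ q != 0 by rewrite expf_neq0 // gt_eqF.
  move: (N ^+ q) (C ^+ q) => x y x0; have := gt_eqF N0 => /negbT Nn0.
  by field; rewrite x0 Nn0.
have -> : r`!.+1%:R * (C / N) ^+ r * (n%:R * B) = r`!.+1%:R * n%:R * (C ^+ (2 * r) / N).
  by rewrite -E; ring.
rewrite -[leRHS]mulrA ler_wpM2r ?ler_wpM2l //.
by rewrite divr_ge0 ?exprn_ge0 // ltW.
Qed.

End DetSquares.

(** * Complete multipartite graphs *)

Section EdgeSums.
Variables (V : finType) (x0 : V) (e : rel V).
Hypotheses (e_irr : irreflexive e) (e_sym : symmetric e).

Lemma hd_tl_set2 (x y : V) : x != y ->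
  (hd x0 [set x; y]%SET = x /\ tl x0 [set x; y]%SET = y) \/
  (hd x0 [set x; y]%SET = y /\ tl x0 [set x; y]%SET = x).
Proof.
move=> xy; have c2 : #|[set x; y]%SET| = 2%N by rewrite cards2 xy.
have [E nht] := hd_tl x0 c2.
have : hd x0 [set x; y]%SET \in [set x; y]%SET by rewrite {2}E set21.
have : tl x0 [set x; y]%SET \in [set x; y]%SET by rewrite {2}E set22.
move: nht; move: (hd _ _) (tl _ _) => h t ht /set2P[] ? /set2P[] ?; subst.
- by rewrite eqxx in ht.
- by right.
- by left.
- by rewrite eqxx in ht.
Qed.

Lemma edges_hd_tl f : f \in edges e ->
  e (hd x0 f) (tl x0 f) /\ f = [set hd x0 f; tl x0 f]%SET.
Proof.
move=> Ef; have [E ht] := hd_tl x0 (edges_loopless e_irr (fintype.subxx _) Ef); split => //.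
move: Ef; rewrite inE => /existsP[x /existsP[y /andP[exy /eqP Ef]]].
have xy : x != y by apply: contraTneq exy => ->; rewrite e_irr.
by case: (hd_tl_set2 xy); rewrite -Ef => -[-> ->] //; rewrite e_sym.
Qed.

Lemma mem_hd_tl (R : pzSemiRingType) f x : f \in edges e ->
  (x \in f)%:R = (x == hd x0 f)%:R + (x == tl x0 f)%:R :> R.
Proof.
move=> Ef; have [E ht] := hd_tl x0 (edges_loopless e_irr (fintype.subxx _) Ef).
rewrite {1}E !inE; case: eqVneq => [->|]; last by rewrite add0r.
by rewrite (negPf ht) addr0.
Qed.

(** Both factors change sign with the orientation of the edge, so an edge from [u] to [w]
    contributes [h u - h w] either way. *)
Lemma sum_laplacian (K : pzRingType) (h : V -> K) u :
  \sum_(f in edges e) (inc x0 (Some f) u)%:~R * (h (hd x0 f) - h (tl x0 f)) =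
  \sum_(w | e u w) (h u - h w).
Proof.
rewrite (bigID (fun f : {set V} => u \in f)) /= [X in _ + X]big1 ?addr0; last first.
  move=> f /andP[/edges_hd_tl[_ E]]; rewrite {1}E !inE negb_or => /andP[/negPf ux /negPf uy].
  by rewrite /= ux uy subrr mul0r.
pose i_ (w : V) := [set u; w]%SET.
have inj_i : {in [set w | e u w]%SET &, injective i_}.
  move=> w w'; rewrite !inE => uw uw' /setP /(_ w); rewrite !inE eqxx orbT.
  case: eqVneq => [E|_ /esym/eqP //]; by rewrite E e_irr in uw.
transitivity (\sum_(f in [set i_ w | w in [set w | e u w]%SET]%SET)
    (inc x0 (Some f) u)%:~R * (h (hd x0 f) - h (tl x0 f))).
  apply: eq_bigl => f; apply/andP/imsetP => [[Ef uf]|[w]].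
    have [ext Ef'] := edges_hd_tl Ef; move: uf; rewrite {1}Ef' => /set2P[E|E].
      by exists (tl x0 f); rewrite /i_ ?inE E // -Ef'.
    by exists (hd x0 f); rewrite /i_ ?inE E 1?e_sym // finset.setUC -Ef'.
  rewrite inE => uw ->; split; last exact: set21.
  by rewrite inE; apply/existsP; exists u; apply/existsP; exists w; rewrite uw eqxx.
rewrite (big_imset _ inj_i) /=; apply: eq_big => [w|w]; rewrite inE // => uw.
have nuw : u != w by apply: contraTneq uw => ->; rewrite e_irr.
case: (hd_tl_set2 nuw) => -[-> ->]; rewrite eqxx (negPf nuw).
  by rewrite subr0 mul1r.
by rewrite sub0r mulrN1z mulN1r opprB.
Qed.

Lemma card_edges_at x : (#|[set f in edges e | x \in f]%SET| <= #|V|)%N.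
Proof.
apply: leq_trans (leq_imset_card (fun y => [set x; y]%SET) predT).
apply/subset_leq_card/fintype.subsetP => f; rewrite inE => /andP[/edges_hd_tl[_ E]].
rewrite {1}E => /set2P[] ->; apply/imsetP.
  by exists (tl x0 f).
by exists (hd x0 f) => //; rewrite finset.setUC.
Qed.

Lemma card_edges : (#|edges e| <= #|V| ^ 2)%N.
Proof.
rewrite -mulnn -card_prod.
apply: leq_trans (leq_imset_card (fun p : V * V => [set p.1; p.2]%SET) predT).
apply/subset_leq_card/fintype.subsetP => f; rewrite inE => /existsP[x /existsP[y /andP[_ /eqP->]]].
by apply/imsetP; exists (x, y).
Qed.

Lemma sum_edges_ends (R : numDomainType) (u : V -> R) : (forall x, 0 <= u x) ->
  \sum_(f in edges e) (u (hd x0 f) + u (tl x0 f)) <= #|V|%:R * \sum_x u x.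
Proof.
move=> u0.
have E f : f \in edges e -> u (hd x0 f) + u (tl x0 f) = \sum_x (x \in f)%:R * u x.
  move=> Ef; have d y : u y = \sum_x (x == y)%:R * u x.
    by rewrite (bigD1 y) //= eqxx mul1r big1 ?addr0 // => x /negPf ->; rewrite mul0r.
  rewrite (d (hd x0 f)) (d (tl x0 f)) -big_split; apply: eq_bigr => x _ /=.
  by rewrite -mulrDl (mem_hd_tl _ _ Ef).
rewrite (eq_bigr _ E) exchange_big mulr_sumr; apply: ler_sum => x _ /=.
rewrite -mulr_suml ler_wpM2r // -natr_sum ler_nat.
apply: leq_trans (card_edges_at x); rewrite -sum1_card [leqRHS]big_mkcond [leqLHS]big_mkcond /=.
by apply: leq_sum => f _; rewrite [X in if X then 1%N else _]inE; case: (f \in edges e) => //=; case: (x \in f).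
Qed.

(** Each vertex is an end of at most |V| edges, used once for [f] and once for [g]. The scarcity of
    meeting edges thus enters through the size of [G] near its diagonal, with no case distinction on
    pairs of edges. *)
Lemma sum_transfer_le (R : numFieldType) (G : V -> V -> R) :
  \sum_(f in edges e) \sum_(g in edges e) `|transfer x0 G f g| <=
  #|V|%:R ^+ 2 * \sum_x \sum_y `|G x y|.
Proof.
pose H f y := `|G (hd x0 f) y| + `|G (tl x0 f) y|.
apply: (@le_trans _ _ (\sum_(f in edges e) \sum_(g in edges e)
    (H f (hd x0 g) + H f (tl x0 g)))).
  apply: ler_sum => f _; apply: ler_sum => g _; rewrite /transfer /H addrACA [leRHS]addrACA.
  apply: le_trans (ler_normB _ _) _; apply: le_trans (lerD (ler_normB _ _) (ler_normB _ _)) _.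
  by rewrite addrACA.
apply: (@le_trans _ _ (\sum_(f in edges e) #|V|%:R * \sum_y H f y)).
  by apply: ler_sum => f _; apply: sum_edges_ends => y; rewrite addr_ge0.
rewrite -mulr_sumr expr2 -mulrA ler_wpM2l //.
apply: le_trans (sum_edges_ends (u := fun x => \sum_y `|G x y|) _) => [|x].
  by apply: ler_sum => f _; rewrite -big_split.
exact: sumr_ge0.
Qed.

End EdgeSums.

Section Multipartite.
Variables (R : realFieldType) (d : nat) (m : 'I_d -> nat).
Local Notation V := (multipartite_vertex m).
Local Notation e := (multipartite m).
Local Notation Nn := (\sum_(i < d) m i)%N.
Variable x0 : V.
Hypothesis m_lt : forall i, (m i < Nn)%N.
Local Notation N := (Nn%:R : R).

Lemma multipartite_irr : irreflexive e.
Proof. by move=> u; rewrite /multipartite eqxx. Qed.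

Lemma multipartite_sym : symmetric e.
Proof. by move=> u v; rewrite /multipartite eq_sym. Qed.

Lemma sum_tag (K : nmodType) (F : 'I_d -> K) :
  \sum_(v : V) F (tag v) = \sum_i F i *+ m i.
Proof.
rewrite -(@sig_big_dep _ _ _ _ (fun i => 'I_(m i)) predT (fun _ => predT) (fun i _ => F i)) /=.
by apply: eq_bigr => i _; rewrite sumr_const card_ord.
Qed.

Lemma card_multipartite : #|V| = Nn.
Proof.
rewrite -sum1_card (@sum_tag nat (fun=> 1%N)); apply: eq_bigr => i _.
exact: natn.
Qed.

(** The degree of every vertex of part [i]. *)
Definition codeg (i : 'I_d) : R := N - (m i)%:R.

Lemma codeg_gt0 i : 0 < codeg i.
Proof. by rewrite subr_gt0 ltr_nat. Qed.

Lemma order_gt0 : 0 < N.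
Proof. by rewrite ltr0n; apply: leq_trans (m_lt (tag x0)). Qed.

(* With J the all-ones matrix, L + J is block diagonal with blocks
   (N - m_i) I + J, and green is its inverse. *)
Definition green (u v : V) : R :=
  (u == v)%:R / codeg (tag v) - (tag u == tag v)%:R / (N * codeg (tag v)).

Lemma sum_green v : \sum_u green u v = N^-1.
Proof.
have a0 := codeg_gt0 (tag v); have N0 := order_gt0.
rewrite sumrB -!mulr_suml (bigD1 v) //= eqxx big1 => [|u /negPf->] //.
rewrite (sum_tag (fun i => (i == tag v)%:R)) (bigD1 (tag v)) //= eqxx big1 => [|i /negPf->]; last first.
  by rewrite mul0rn.
have : codeg (tag v) != 0 by rewrite gt_eqF.
rewrite /codeg => a0'; rewrite !addr0 /=.
by field; rewrite a0' gt_eqF.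
Qed.

Lemma sum_nonneighbours u : \sum_(w | e u w) 1 = codeg (tag u).
Proof.
have := congr1 (fun k : nat => k%:R : R) card_multipartite.
rewrite -sum1_card natr_sum (bigID (fun w : V => tag u == tag w)) /= => E.
rewrite /codeg -E addrAC [X in X + _](_ : _ = 0) ?add0r //.
apply/eqP; rewrite subr_eq0 big_mkcond /=; apply/eqP.
transitivity (\sum_(w : V) (tag w == tag u)%:R : R).
  by apply: eq_bigr => w _; rewrite eq_sym; case: eqP.
rewrite (sum_tag (fun i => (i == tag u)%:R)) (bigD1 (tag u)) //= eqxx big1 ?addr0 //.
by move=> i /negPf->; rewrite mul0rn.
Qed.

(** The defect [N^-1] is the column sum of [green]. It does not depend on [v], so it cancels between
    two columns. *)
Lemma laplacian_green u v :
  \sum_(w | e u w) (green u v - green w v) = (u == v)%:R - N^-1.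
Proof.
have a0 : codeg (tag v) != 0 by rewrite gt_eqF // codeg_gt0.
have N0 : N != 0 by rewrite gt_eqF // order_gt0.
rewrite sumrB -[X in \sum_(w | _) X]mul1r -mulr_suml sum_nonneighbours.
have green0 w : tag w != tag v -> green w v = 0.
  move=> wv; rewrite /green (negPf wv) mul0r subr0 (_ : (w == v) = false) ?mul0r //.
  by apply: contraNF wv => /eqP->.
have [uv|uv] := eqVneq (tag u) (tag v).
  rewrite [X in _ - X]big1 => [|w uw]; last by rewrite green0 // -uv eq_sym.
  by rewrite subr0 /green uv eqxx /=; field; rewrite a0 N0.
rewrite green0 // mulr0 sub0r -(sum_green v).
have -> : (u == v) = false by apply: contraNF uv => /eqP->.
rewrite sub0r; congr (- _); rewrite big_mkcond /=; apply: eq_bigr => w _.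
case: ifPn => //; rewrite /multipartite negbK => /eqP uw.
by rewrite green0 // -uw.
Qed.

(** Subtracting the column of [x0] cancels the defect [N^-1] but leaves [-(u == x0)]. The terms
    constant in [u] are chosen to make [potential x0 v = 1], so that the grounding term restores
    exactly this. All corrections depend on at most one argument. *)
Definition potential (u v : V) : R :=
  green u v - green u x0 + 1 - green x0 v + green x0 x0.

Lemma potential_inv u v : (u == x0)%:R * potential x0 v +
  \sum_(f in edges e) (inc x0 (Some f) u)%:~R *
     (potential (hd x0 f) v - potential (tl x0 f) v) = (u == v)%:R.
Proof.
rewrite (sum_laplacian x0 multipartite_irr multipartite_sym (potential^~ v)).
rewrite (eq_bigr (fun w => (green u v - green w v) - (green u x0 - green w x0))); last first.
  by move=> w _; rewrite /potential; ring.
by rewrite sumrB !laplacian_green /potential; ring.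
Qed.

Lemma transfer_potential f g : transfer x0 potential f g = transfer x0 green f g.
Proof. by rewrite /transfer /potential; ring. Qed.

Definition edge_prob (i j : 'I_d) : R := (1 - N^-1) * ((codeg i)^-1 + (codeg j)^-1).

Lemma transfer_diag f : f \in edges e ->
  transfer x0 green f f = edge_prob (tag (hd x0 f)) (tag (tl x0 f)).
Proof.
move=> /(edges_hd_tl x0 multipartite_irr multipartite_sym)[+ _].
rewrite /transfer; move: (hd x0 f) (tl x0 f) => x y; rewrite /multipartite => xy.
have nxy : x == y = false by apply: contraNF xy => /eqP->.
rewrite /green !eqxx nxy [y == x]eq_sym nxy (negPf xy) [tag y == _]eq_sym (negPf xy).
have N0 : N != 0 by rewrite gt_eqF // order_gt0.
have ax : codeg (tag x) != 0 by rewrite gt_eqF // codeg_gt0.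
have ay : codeg (tag y) != 0 by rewrite gt_eqF // codeg_gt0.
by rewrite /edge_prob /=; field; rewrite N0 ax ay.
Qed.

(** The symmetry of [phi] absorbs the orientation: [hd] need not lie in the part with the smaller
    index. *)
Lemma sum_edges (K : nmodType) (phi : 'I_d -> 'I_d -> K) : (forall i j, phi i j = phi j i) ->
  \sum_(f in edges e) phi (tag (hd x0 f)) (tag (tl x0 f)) =
  \sum_(i < d) \sum_(j < d | (i < j)%N) phi i j *+ (m i * m j).
Proof.
move=> phiC.
pose P := [set p : V * V | (tag p.1 < tag p.2)%N]%SET.
pose i_ (p : V * V) := [set p.1; p.2]%SET.
have inj_i : {in P &, injective i_}.
  move=> [x y] [x' y']; rewrite !inE /i_ /= => xy xy' E.
  have /set2P[?|?] : x \in [set x'; y']%SET by rewrite -E set21.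
    subst x'; have /set2P[?|?] : y \in [set x; y']%SET by rewrite -E set22.
      by subst y; rewrite ltnn in xy.
    by subst y'.
  subst y'; have /set2P[?|?] : y \in [set x'; x]%SET by rewrite -E set22.
    by subst y; move: (ltn_trans xy xy'); rewrite ltnn.
  by subst y; rewrite ltnn in xy.
have -> : edges e = (i_ @: P)%SET.
  apply/setP => f; rewrite inE; apply/existsP/imsetP => [[x /existsP[y /andP[xy /eqP->]]]|[[x y]]].
    move: xy; rewrite /multipartite neq_ltn => /orP[xy|yx].
      by exists (x, y); rewrite ?inE.
    by exists (y, x); rewrite ?inE // /i_ finset.setUC.
  rewrite inE /= => xy ->; exists x; apply/existsP; exists y.
  by rewrite eqxx andbT /multipartite neq_ltn xy.
rewrite (big_imset _ inj_i) /=.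
transitivity (\sum_(p in P) phi (tag p.1) (tag p.2)).
  apply: eq_bigr => -[x y]; rewrite inE /= => xy.
  have nxy : x != y by apply: contraTneq xy => ->; rewrite ltnn.
  by case: (hd_tl_set2 x0 nxy) => -[-> ->].
transitivity (\sum_(x : V) \sum_(y : V | (tag x < tag y)%N) phi (tag x) (tag y)).
  by rewrite pair_big_dep /=; apply: eq_bigl => p; rewrite inE.
rewrite (sum_tag (fun i => \sum_(y : V | (i < tag y)%N) phi i (tag y))).
apply: eq_bigr => i _; rewrite big_mkcond (sum_tag (fun j => if (i < j)%N then phi i j else 0)).
rewrite -sumrMnl [RHS]big_mkcond; apply: eq_bigr => j _.
by case: ifP; rewrite ?mul0rn // mulnC mulrnA.
Qed.

Definition mean_common : R :=
  \sum_(i < d) \sum_(j < d | (i < j)%N) edge_prob i j ^+ 2 *+ (m i * m j).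

Lemma sum_transfer_diag : \sum_(f in edges e) transfer x0 green f f ^+ 2 = mean_common.
Proof.
rewrite (eq_bigr (fun f : {set V} => edge_prob (tag (hd x0 f)) (tag (tl x0 f)) ^+ 2)).
  by apply: (@sum_edges _ (fun i j => edge_prob i j ^+ 2)) => i j; rewrite /edge_prob [_^-1 + _]addrC.
by move=> f /transfer_diag ->.
Qed.

Section Bounds.
Variable delta : R.
Hypotheses (delta0 : 0 < delta) (codeg_ge : forall i, delta * N <= codeg i).

Lemma green_le u v : `|green u v| <= (u == v)%:R / (delta * N) + (delta * N ^+ 2)^-1.
Proof.
have N0 := order_gt0; have a0 := codeg_gt0 (tag v).
have dN0 : 0 < delta * N by rewrite mulr_gt0.
rewrite /green; apply: le_trans (ler_normB _ _) _; rewrite lerD //.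
  rewrite ger0_norm; last by rewrite divr_ge0 // ltW.
  by rewrite ler_wpM2l // lef_pV2 ?posrE // codeg_ge.
rewrite ger0_norm; last by rewrite divr_ge0 ?mulr_ge0 // ltW.
apply: (@le_trans _ _ (N * codeg (tag v))^-1).
  rewrite ler_piMl ?invr_ge0 //; first by rewrite mulr_ge0 // ltW.
  by case: eqP.
rewrite lef_pV2 ?posrE ?mulr_gt0 ?exprn_gt0 //.
by rewrite expr2 mulrA [leLHS]mulrC ler_wpM2l // codeg_ge.
Qed.

(** Four values of [green], each at most [2 / delta / N], give the constant 8. *)
Lemma transfer_le f g : `|transfer x0 green f g| <= 8 / delta / N.
Proof.
have N0 := order_gt0.
have g2 u v : `|green u v| <= 2 / delta / N.
  apply: le_trans (green_le u v) _.
  have -> : 2 / delta / N = (delta * N)^-1 + (delta * N)^-1.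
    by field; rewrite !gt_eqF.
  rewrite lerD //.
    rewrite ler_piMl ?invr_ge0 //; first by rewrite mulr_ge0 // ltW.
    by case: eqP.
  rewrite lef_pV2 ?posrE ?mulr_gt0 ?exprn_gt0 // ler_pM2l // expr2 ler_peMr //.
  by rewrite -[1]/(1%:R) ler_nat -(ltr_nat R).
rewrite /transfer; apply: le_trans (ler_normB _ _) _.
apply: le_trans (lerD (ler_normB _ _) (ler_normB _ _)) _.
apply: le_trans (lerD (lerD (g2 _ _) (g2 _ _)) (lerD (g2 _ _) (g2 _ _))) _.
by rewrite le_eqVlt; apply/orP; left; apply/eqP; field; rewrite !gt_eqF.
Qed.

(** The N diagonal terms of order 1/N and the N^2 terms of order 1/N^2 contribute [1 / delta]
    each. *)
Lemma sum_green_le : \sum_(u : V) \sum_(v : V) `|green u v| <= 2 / delta.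
Proof.
have N0 := order_gt0.
apply: (@le_trans _ _ (\sum_(u : V) 2 / delta / N)); last first.
  rewrite sumr_const -/(#|{: V}|) card_multipartite -[leLHS]mulr_natr.
  by rewrite divfK // gt_eqF.
apply: ler_sum => u _; apply: le_trans (ler_sum _ (fun v _ => green_le u v)) _.
rewrite big_split /= (bigD1 u) //= eqxx [X in _ + X + _]big1 => [|v]; last first.
  by rewrite eq_sym => /negPf->; rewrite mul0r.
rewrite sumr_const -/(#|{: V}|) card_multipartite -[X in _ + X <= _]mulr_natr.
rewrite addr0 /= le_eqVlt; apply/orP; left; apply/eqP. by field; rewrite !gt_eqF.
Qed.

Theorem factorial_moment_approx r :
  `|r`!%:R * (\sum_(F in spanning_trees e) \sum_(F' in spanning_trees e)
       ('C(#|F :&: F'|, r))%:R) / #|spanning_trees e|%:R ^+ 2 - mean_common ^+ r|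
  <= (r`!.+1)%:R * r`!%:R * (8 / delta) ^+ (2 * r) / N.
Proof.
have N0 := order_gt0.
rewrite (factorial_moment multipartite_irr potential_inv) mulrAC mulfV ?mul1r; last first.
  by rewrite expf_neq0 // (trees_neq0 multipartite_irr potential_inv).
rewrite -sum_transfer_diag.
under eq_bigr => g _.
  rewrite (_ : \matrix_(i, j) _ = \matrix_(i, j) transfer x0 green (g i) (g j)); last first.
    by apply/matrixP => i j; rewrite !mxE transfer_potential.
  over.
(* The constant [8 / delta] comes from the entrywise bound; the [2 / delta] of the summed bound is
   relaxed to it. *)
apply: sum_det_sqr_approx => //.
- by rewrite divr_ge0 // ltW.
- by move=> f g _ _; exact: transfer_le.
- apply: le_trans (sum_transfer_le x0 multipartite_irr multipartite_sym green) _.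
  rewrite card_multipartite mulrC ler_wpM2r ?sqr_ge0 //.
  apply: le_trans sum_green_le _; rewrite ler_wpM2r ?ler_nat //.
  by rewrite invr_ge0 ltW.
- by rewrite -natrX ler_nat -card_multipartite (card_edges e).
Qed.

End Bounds.
End Multipartite.

(** * The method of moments for the Poisson law *)

Local Open Scope classical_set_scope.
Local Open Scope ring_scope.

(** Pascal's rule makes the partial sums telescope. *)
Lemma alternating_bin (R : pzRingType) y s :
  \sum_(i < s.+1) (-1) ^+ i * 'C(y.+1, i)%:R = (-1) ^+ s * 'C(y, s)%:R :> R.
Proof.
elim: s => [|s IHs]; first by rewrite big_ord1 !bin0.
by rewrite big_ord_recr /= IHs binS natrD mulrDr exprS addrCA mulN1r !mulNr subrr addr0.
Qed.

Lemma alternating_bin_le (R : numDomainType) y s :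
  `|(y == 0)%:R - \sum_(i < s.+1) (-1) ^+ i * 'C(y, i)%:R| <= 'C(y, s.+1)%:R :> R.
Proof.
case: y => [|y].
  rewrite big_ord_recl /= big1 => [|i _]; last by rewrite /= bin0n mulr0.
  by rewrite bin0 mulr1 addr0 subrr normr0.
rewrite alternating_bin sub0r normrN normrM normrX normrN1 expr1n mul1r normr_nat.
by rewrite binS natrD lerDr.
Qed.

Lemma bin_mul_bin x m s : ('C(x, m + s) * 'C(m + s, m) = 'C(x, m) * 'C(x - m, s))%N.
Proof.
have [xs|msx] := ltnP x (m + s).
  rewrite bin_small // mul0n; have [xm|mx] := ltnP x m; first by rewrite bin_small.
  by rewrite (@bin_small (x - m)) ?muln0 // ltn_subLR.
have mx : (m <= x)%N by apply: leq_trans msx; exact: leq_addr.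
have sx : (s <= x - m)%N by rewrite leq_subRL.
have e1 := bin_fact msx; have e2 := bin_fact (leq_addr s m).
have e3 := bin_fact mx; have e4 := bin_fact sx.
rewrite addKn in e2; rewrite -subnDA in e4.
apply/eqP; rewrite -(eqn_pmul2r (fact_gt0 m)) -(eqn_pmul2r (fact_gt0 s)).
rewrite -(eqn_pmul2r (fact_gt0 (x - (m + s)))); apply/eqP.
transitivity x`!; first by rewrite -e1 -e2; ring.
by rewrite -e3 -e4; ring.
Qed.

(** Extracting ['C(x, m)] from every term reduces to the case m = 0 at [x - m]. For x < m the
    extracted factor is 0, which takes care of the truncated subtraction. *)
Lemma bonferroni (R : numDomainType) x m s :
  `|(x == m)%:R - \sum_(i < s.+1) (-1) ^+ i * 'C(m + i, m)%:R * 'C(x, m + i)%:R|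
  <= 'C(m + s.+1, m)%:R * 'C(x, m + s.+1)%:R :> R.
Proof.
rewrite -natrM mulnC bin_mul_bin natrM.
under eq_bigr do rewrite -mulrA -natrM mulnC bin_mul_bin natrM mulrCA.
have -> : (x == m)%:R = 'C(x, m)%:R * (x - m == 0)%N%:R :> R.
  case: (ltngtP x m) => [xm|mx|->].
  - by rewrite bin_small // mul0r.
  - by rewrite subn_eq0 leqNgt mx mulr0.
  - by rewrite binn subnn mulr1.
rewrite -mulr_sumr -mulrBr normrM normr_nat ler_wpM2l //.
exact: alternating_bin_le.
Qed.

(** The limit in [k] is taken at a fixed truncation [s], where the error may stay positive; it only
    has to vanish as [s] grows afterwards. No uniformity in [s] is involved. *)
Lemma cvg_of_approximations (R : realType) (a : nat -> R) (u b : nat -> nat -> R) (U B : nat -> R) (L : R) :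
  (forall s, \forall k \near \oo, `|a k - u s k| <= b s k) ->
  (forall s, u s k @[k --> \oo] --> U s) -> (forall s, b s k @[k --> \oo] --> B s) ->
  U s @[s --> \oo] --> L -> B s @[s --> \oo] --> 0 -> a k @[k --> \oo] --> L.
Proof.
move=> aub uU bB UL B0; apply/cvgrPdist_lt => eps eps0.
have e4 : 0 < eps / 4 by rewrite divr_gt0.
move/cvgrPdist_lt : UL => /(_ _ e4) UL; move/cvgrPdist_lt : B0 => /(_ _ e4) B0.
have [s [ULs Bs]] : exists s, `|L - U s| < eps / 4 /\ `|0 - B s| < eps / 4.
  by near \oo => s; exists s; split; near: s.
move/cvgrPdist_lt : (uU s) => /(_ _ e4) uUs; move/cvgrPdist_lt : (bB s) => /(_ _ e4) bBs.
near=> k.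
have h1 : `|a k - u s k| <= b s k by near: k; exact: aub.
have h2 : `|U s - u s k| < eps / 4 by near: k.
have h3 : `|B s - b s k| < eps / 4 by near: k.
move: ULs Bs h1 h2 h3; rewrite !(ltr_norml, ler_norml) => /andP[? ?] /andP[? ?] /andP[? ?] /andP[? ?] /andP[? ?].
by apply/andP; split; lra.
Unshelve. all: by end_near. Qed.

(* Method of moments for the Poisson law: F k r is the r-th binomial moment. *)
Lemma cvg_poisson_of_moments (R : realType) (lam : R) (p : nat -> nat -> R) (F : nat -> nat -> R) m :
  (forall s, \forall k \near \oo,
     `|p k m - \sum_(i < s.+1) (-1) ^+ i * 'C(m + i, m)%:R * F k (m + i)%N|
     <= 'C(m + s.+1, m)%:R * F k (m + s.+1)%N) ->
  (forall r, F k r @[k --> \oo] --> lam ^+ r / r`!%:R) ->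
  p k m @[k --> \oo] --> lam ^+ m / m`!%:R * expR (- lam).
Proof.
move=> pF Fl.
have f0 q : q`!%:R != 0 :> R by rewrite pnatr_eq0 -lt0n fact_gt0.
have binE i : 'C(m + i, m)%:R * (lam ^+ (m + i) / (m + i)`!%:R) =
    lam ^+ m / m`!%:R * (lam ^+ i / i`!%:R).
  have e := bin_fact (leq_addr i m); rewrite addKn in e.
  rewrite -e !natrM exprD; field.
  by rewrite !f0 pnatr_eq0 -lt0n bin_gt0 leq_addr.
apply: (cvg_of_approximations pF (U := fun s => lam ^+ m / m`!%:R * series (exp_coeff (- lam)) s.+1)
  (B := fun s => lam ^+ m / m`!%:R * exp_coeff lam s.+1)).
- move=> s; rewrite /series /= big_mkord mulr_sumr.
  apply: cvg_big => [|i _]; first exact: add_continuous.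
  have -> : lam ^+ m / m`!%:R * ((- lam) ^+ i / i`!%:R) =
      (-1) ^+ i * 'C(m + i, m)%:R * (lam ^+ (m + i) / (m + i)`!%:R).
    by rewrite -[RHS]mulrA binE (exprNn lam) -[(-1) ^+ i * _ / _]mulrA [LHS]mulrCA.
  by apply: cvgMr; exact: Fl.
- by move=> s; rewrite /exp_coeff /= -binE; apply: cvgMr; exact: Fl.
- apply: cvgMr; rewrite (cvg_shiftS (series (exp_coeff (- lam)))).
  exact: is_cvg_series_exp_coeff.
- rewrite -[X in _ --> X](mulr0 (lam ^+ m / m`!%:R)); apply: cvgMr.
  rewrite (cvg_shiftS (exp_coeff lam)); exact: cvg_exp_coeff.
Qed.

Section MeanCommon.
Variables (R : realFieldType) (E : finType) (T : {set {set E}}).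

(** The expectation of [phi] at the number of common elements of two independent uniform members of
    [T]. For empty [T] it is 0, so the linear rules and the Bonferroni bound hold for every [T]. *)
Definition mean_over_pairs (phi : nat -> R) : R :=
  (\sum_(F in T) \sum_(F' in T) phi #|F :&: F'|) / #|T|%:R ^+ 2.

Lemma mean_over_pairsB phi psi :
  mean_over_pairs (fun x => phi x - psi x) = mean_over_pairs phi - mean_over_pairs psi.
Proof.
rewrite /mean_over_pairs -mulrBl -sumrB; congr (_ / _).
by apply: eq_bigr => F _; rewrite sumrB.
Qed.

Lemma mean_over_pairsZ a phi :
  mean_over_pairs (fun x => a * phi x) = a * mean_over_pairs phi.
Proof.
rewrite /mean_over_pairs mulrA mulr_sumr; congr (_ / _).
by apply: eq_bigr => F _; rewrite mulr_sumr.
Qed.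

Lemma mean_over_pairs_sum I (r : seq I) (P : pred I) (phi : I -> nat -> R) :
  mean_over_pairs (fun x => \sum_(i <- r | P i) phi i x) =
  \sum_(i <- r | P i) mean_over_pairs (phi i).
Proof.
rewrite /mean_over_pairs -mulr_suml; congr (_ / _).
by rewrite [RHS]exchange_big /=; apply: eq_bigr => F _; rewrite exchange_big.
Qed.

Lemma mean_over_pairs_le phi psi : (forall x, `|phi x| <= psi x) ->
  `|mean_over_pairs phi| <= mean_over_pairs psi.
Proof.
move=> le; rewrite normrM [`|_^-1|]ger0_norm ?invr_ge0 ?sqr_ge0 //.
rewrite ler_wpM2r ?invr_ge0 ?sqr_ge0 //.
apply: le_trans (ler_norm_sum _ _ _) _; apply: ler_sum => F _.
by apply: le_trans (ler_norm_sum _ _ _) _; exact: ler_sum.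
Qed.

Lemma mean_over_pairs_bonferroni m s :
  `|mean_over_pairs (fun x => (x == m)%:R)
    - \sum_(i < s.+1) (-1) ^+ i * 'C(m + i, m)%:R *
        mean_over_pairs (fun x => 'C(x, m + i)%:R)|
  <= 'C(m + s.+1, m)%:R * mean_over_pairs (fun x => 'C(x, m + s.+1)%:R).
Proof.
under eq_bigr do rewrite -mean_over_pairsZ.
rewrite -mean_over_pairs_sum -mean_over_pairsB -mean_over_pairsZ.
by apply: mean_over_pairs_le => x; exact: bonferroni.
Qed.

End MeanCommon.

(** * Asymptotics along the sequence of multipartite graphs *)

Section MultipartiteLimit.
Variables (R : realType) (d : nat).
Hypothesis hd : (1 < d)%N.
Variables (c : 'I_d -> R) (n : nat -> 'I_d -> nat).
Hypothesis hc : forall i, 0 < c i.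
Hypothesis hn : (\sum_(i < d) n k i)%N @[k --> \oo] --> \oo.
Hypothesis hnc : forall i : 'I_d,
  ((n k i)%:R / (\sum_(j < d) n k j)%N%:R : R) @[k --> \oo] --> c i.

Local Notation N k := (\sum_(i < d) n k i)%N.

Definition limit_rate : R := \sum_(i < d) \sum_(j < d | (i < j)%N)
  c i * c j * (2 - c i - c j) ^+ 2 / ((1 - c i) ^+ 2 * (1 - c j) ^+ 2).

Lemma order_near_gt0 : \forall k \near \oo, (0 < N k)%N.
Proof. by move/cvgnyPge : hn => /(_ 1%N). Qed.

Lemma order_inv_cvg0 : ((N k)%:R^-1 : R) @[k --> \oo] --> 0.
Proof.
apply/gtr0_cvgV0; last exact/cvgrnyP.
by near=> k; rewrite ltr0n; near: k; exact: order_near_gt0.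
Unshelve. all: by end_near. Qed.

Lemma sum_proportions : \sum_i c i = 1.
Proof.
have h1 : \sum_i ((n k i)%:R / (N k)%:R : R) @[k --> \oo] --> \sum_i c i.
  by apply: cvg_big => [|i _]; [exact: add_continuous | exact: hnc].
have h2 : \sum_i ((n k i)%:R / (N k)%:R : R) @[k --> \oo] --> (1 : R).
  apply: cvg_near_cst; near=> k.
  rewrite -mulr_suml -natr_sum mulfV // pnatr_eq0 -lt0n.
  by near: k; exact: order_near_gt0.
exact: cvg_unique h1 h2.
Unshelve. all: by end_near. Qed.

(** The proportions add up to 1, and as d > 1 another part takes a positive share. *)
Lemma proportion_lt1 i : c i < 1.
Proof.
have [j ji] : exists j : 'I_d, j != i.
  have [E|ne] := eqVneq (Ordinal (ltnW hd)) i; last by exists (Ordinal (ltnW hd)).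
  by exists (Ordinal hd); rewrite -E.
rewrite -sum_proportions (bigD1 i) //= ltrDl (bigD1 j) //= ltr_pwDl //.
by apply: sumr_ge0 => k _; exact: ltW.
Qed.

(** [poisson_pmf] and [poisson_prob] branch on the sign of the rate. *)
Lemma limit_rate_gt0 : 0 < limit_rate.
Proof.
pose t i j := c i * c j * (2 - c i - c j) ^+ 2 / ((1 - c i) ^+ 2 * (1 - c j) ^+ 2).
have t0 i j : 0 < t i j.
  have := proportion_lt1 i; have := proportion_lt1 j => cj ci.
  by rewrite /t divr_gt0 ?mulr_gt0 ?exprn_gt0 //; lra.
rewrite /limit_rate (bigD1 (Ordinal (ltnW hd))) //= (bigD1 (Ordinal hd)) //= -addrA.
rewrite ltr_pwDl ?t0 // addr_ge0 //; first by apply: sumr_ge0 => j _; exact/ltW/t0.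
by apply: sumr_ge0 => i _; apply: sumr_ge0 => j _; exact/ltW/t0.
Qed.

Lemma mean_common_cvg : mean_common R (n k) @[k --> \oo] --> limit_rate.
Proof.
apply: cvg_big => [|i _]; first exact: add_continuous.
apply: cvg_big => [|j _]; first exact: add_continuous.
have nz l : 1 - c l != 0 by rewrite subr_eq0 eq_sym lt_eqF // proportion_lt1.
have inv_cvg l : ((1 - (n k l)%:R / (N k)%:R)^-1 : R) @[k --> \oo] --> (1 - c l)^-1.
  by apply: cvgV => //; apply: cvgB; [exact: cvg_cst | exact: hnc].
pose q k : R := (1 - (N k)%:R^-1) *
  ((1 - (n k i)%:R / (N k)%:R)^-1 + (1 - (n k j)%:R / (N k)%:R)^-1).
(* Here [q k] is N times [edge_prob]: the N^2 in the number of edges is distributed over the two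
   factors of the square. *)
have qE : \forall k \near \oo, ((n k i)%:R / (N k)%:R) * ((n k j)%:R / (N k)%:R) * (q k * q k) =
    edge_prob R (n k) i j ^+ 2 *+ (n k i * n k j).
  near=> k.
  have N0 : (N k)%:R != 0 :> R.
    by rewrite pnatr_eq0 -lt0n; near: k; exact: order_near_gt0.
  have E l : (codeg R (n k) l)^-1 = (N k)%:R^-1 * (1 - (n k l)%:R / (N k)%:R)^-1.
    by rewrite -invfM mulrBr mulr1 mulrCA mulfV // mulr1.
  rewrite /edge_prob !E -mulrDr -[RHS]mulr_natl natrM /q.
  move: (1 - _)^-1 (1 - (n k j)%:R / _)^-1 => x y.
  by field.
apply: cvg_trans (near_eq_cvg qE) _.
have -> : c i * c j * (2 - c i - c j) ^+ 2 / ((1 - c i) ^+ 2 * (1 - c j) ^+ 2) =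
    c i * c j * (((1 - 0) * ((1 - c i)^-1 + (1 - c j)^-1)) *
                 ((1 - 0) * ((1 - c i)^-1 + (1 - c j)^-1))).
  by field; rewrite !nz.
have qc : q k @[k --> \oo] --> (1 - 0) * ((1 - c i)^-1 + (1 - c j)^-1).
  apply: cvgM; last by apply: cvgD.
  by apply: cvgB; [exact: cvg_cst | exact: order_inv_cvg0].
by apply: cvgM; apply: cvgM; rewrite ?hnc.
Unshelve. all: by end_near. Qed.

Lemma near_order_conditions : exists2 delta : R, 0 < delta &
  \forall k \near \oo, exists x0 : multipartite_vertex (n k),
    (forall i, (n k i < N k)%N) /\ (forall i, delta * (N k)%:R <= codeg R (n k) i).
Proof.
(* All factors lie in (0, 1), so the product is at most each [1 - c i]; halving makes the inequality
   strict, hence stable for large [k]. *)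
pose delta := (\prod_i (1 - c i)) / 2.
have c1 i : 0 < 1 - c i by rewrite subr_gt0 proportion_lt1.
have prod0 : 0 < \prod_i (1 - c i) by apply: prodr_gt0.
have delta0 : 0 < delta by rewrite divr_gt0.
have delta_lt i : delta < 1 - c i.
  apply: (@lt_le_trans _ _ (\prod_i (1 - c i))).
    by rewrite /delta; lra.
  rewrite (bigD1 i) //=; apply: ler_piMr; first exact: ltW.
  by apply: Num.Theory.prodr_ile1 => j _; rewrite (ltW (c1 j)) /= gerBl ltW.
exists delta => //.
have near_le i : \forall k \near \oo, (n k i)%:R / (N k)%:R < 1 - delta.
  by apply: (cvgr_lt _ (@hnc i)); have := delta_lt i; lra.
have near_all : \forall k \near \oo, forall i, (n k i)%:R / (N k)%:R < 1 - delta.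
  by apply: filter_forall.
near=> k.
have N0 : (0 < N k)%N by near: k; exact: order_near_gt0.
have NR0 : 0 < (N k)%:R :> R by rewrite ltr0n.
have le i : delta * (N k)%:R < codeg R (n k) i.
  have : forall i, (n k i)%:R / (N k)%:R < 1 - delta by near: k.
  move=> /(_ i); rewrite ltr_pdivrMr // /codeg mulrBl mul1r; lra.
have [i n0] : exists i, (0 < n k i)%N.
  apply/existsP; move: N0; apply: contraTT => /existsPn n0; rewrite -leqNgt leqn0.
  by rewrite big1 // => i _; apply/eqP; rewrite -leqn0 leqNgt.
exists (Tagged (fun i => 'I_(n k i)) (Ordinal n0)); split => [j|j]; last exact/ltW.
by rewrite -(ltr_nat R) -subr_gt0; apply: lt_trans (le j); rewrite mulr_gt0.
Unshelve. all: by end_near. Qed.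

Lemma near_trees_neq0 :
  \forall k \near \oo, #|spanning_trees (multipartite (n k))|%:R != 0 :> R.
Proof.
have [delta delta0 near_ord] := near_order_conditions.
near=> k; have [x0 [lt _]] : exists x0 : multipartite_vertex (n k),
    (forall i, (n k i < N k)%N) /\ (forall i, delta * (N k)%:R <= codeg R (n k) i).
  by near: k.
exact: (trees_neq0 (@multipartite_irr d (n k)) (@potential_inv R d (n k) x0 lt)).
Unshelve. all: by end_near. Qed.

Lemma binomial_moment_cvg r :
  mean_over_pairs (spanning_trees (multipartite (n k))) (fun x => 'C(x, r)%:R)
    @[k --> \oo] --> limit_rate ^+ r / r`!%:R.
Proof.
have [delta delta0 near_ord] := near_order_conditions.
have f0 : r`!%:R != 0 :> R by rewrite pnatr_eq0 -lt0n fact_gt0.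
pose a k : R := mean_over_pairs (spanning_trees (multipartite (n k))) (fun x => 'C(x, r)%:R).
pose K : R := (r`!.+1)%:R * r`!%:R * (8 / delta) ^+ (2 * r).
have near_le : \forall k \near \oo, `|r`!%:R * a k - mean_common R (n k) ^+ r| <= K * (N k)%:R^-1.
  near=> k; have [x0 [lt le]] : exists x0 : multipartite_vertex (n k),
      (forall i, (n k i < N k)%N) /\ (forall i, delta * (N k)%:R <= codeg R (n k) i).
    by near: k.
  by rewrite /a /mean_over_pairs mulrA; exact: factorial_moment_approx.
have : r`!%:R * a k @[k --> \oo] --> limit_rate ^+ r.
  apply: (cvg_of_approximations (u := fun _ k => mean_common R (n k) ^+ r) (b := fun _ k => K * (N k)%:R^-1)
     (U := fun=> limit_rate ^+ r) (B := fun=> 0)).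
  - by [].
  - by move=> _; apply: (continuous_cvg (h := fun x : R => x ^+ r) _ _ mean_common_cvg); exact: exprn_continuous.
  - by move=> _; rewrite -[X in _ --> X](mulr0 K); apply: cvgMr; exact: order_inv_cvg0.
  - exact: cvg_cst.
  - exact: cvg_cst.
move=> h; have : (r`!%:R * a k) * r`!%:R^-1 @[k --> \oo] --> limit_rate ^+ r / r`!%:R.
  exact: cvgMl.
by apply: cvg_trans; apply: near_eq_cvg; near=> k; rewrite mulrAC mulfV // mul1r.
Unshelve. all: by end_near. Qed.

Lemma common_pmf_cvg m :
  mean_over_pairs (spanning_trees (multipartite (n k))) (fun x => (x == m)%:R)
    @[k --> \oo] --> poisson_pmf limit_rate m.
Proof.
rewrite /poisson_pmf limit_rate_gt0.
apply: (cvg_poisson_of_moments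
  (p := fun k m => mean_over_pairs (spanning_trees (multipartite (n k))) (fun x => (x == m)%:R))
  (F := fun k r => mean_over_pairs (spanning_trees (multipartite (n k))) (fun x => 'C(x, r)%:R))).
  by move=> s; near=> k; exact: mean_over_pairs_bonferroni.
exact: binomial_moment_cvg.
Unshelve. all: by end_near. Qed.

End MultipartiteLimit.

(** * Distribution functions *)

Section CommonDistribution.
Context {disp : measure_display} {Om : measurableType disp} {R : realType}.
Variables (P : probability Om R) (E : finType).

Lemma measurable_fiber (Y : {RV P >-> {set E}}) y : measurable (Y @^-1` [set y]).
Proof. exact: (measurable_funPTI Y). Qed.

Lemma prob_fibers (Y : {RV P >-> {set E}}) (A : set Om) : measurable A ->
  P A = (\sum_(y : {set E}) P (A `&` Y @^-1` [set y]))%E.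
Proof.
move=> mA.
have {1}-> : A = \bigcup_(y in [set: {set E}]) (A `&` Y @^-1` [set y]).
  by apply/seteqP; split=> [w Aw|w [y _ []]] //; exists (Y w).
rewrite measure_fin_bigcup //.
- rewrite [RHS]fsbig_seq ?index_enum_uniq //; apply: eq_fsbigl.
  by apply/seteqP; split=> y //= _; rewrite mem_index_enum.
- exact: finite_finset.
- by apply/classical_sets.trivIsetP => y y' _ _ yy'; apply/seteqP; split=> // w [[_ /= Ey] [_ /= Ey']]; case/eqP: yy'; rewrite -Ey -Ey'.
- by move=> y _; apply: measurableI => //; exact: measurable_fiber.
Qed.

(** The masses of the points of [T] already add up to 1, so the nonnegative masses elsewhere
    vanish. *)
Lemma uniform_prob (S : {RV P >-> {set E}}) (T : {set {set E}}) F :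
  uniform_on S T -> #|T|%:R != 0 :> R ->
  P (S @^-1` [set F]) = ((F \in T)%:R / #|T|%:R)%:E.
Proof.
move=> uS T0.
have pE y : P (S @^-1` [set y]) = (fine (P (S @^-1` [set y])))%:E.
  by rewrite fineK // fin_num_measure //; exact: measurable_fiber.
case: (boolP (F \in T)) => FT; first by rewrite uS // mul1r.
have := prob_fibers S (@measurableT _ Om).
rewrite probability_setT.
under eq_bigr do rewrite setTI pE.
rewrite sumEFin => /eqP; rewrite eqe (bigID (mem T)) /=.
rewrite (eq_bigr (fun=> #|T|%:R^-1)) => [|y yT]; last by rewrite uS.
rewrite sumr_const -[_ *+ _]mulr_natr mulVf // => /eqP.
move=> /(congr1 (fun x => x - 1)); rewrite subrr addrAC subrr add0r => /esym/eqP.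
rewrite psumr_eq0 => [|y _]; last by rewrite fine_ge0.
move=> /allP /(_ F); rewrite mem_index_enum FT => /(_ isT) /eqP E0.
by rewrite pE E0 mul0r.
Qed.

(** Splitting over the values of both trees turns the probability into a count, in which the sample
    space, free to vary with [k], no longer appears. *)
Lemma cdf_num_common (S S' : {RV P >-> {set E}}) (T : {set {set E}}) r :
  uniform_on S T -> uniform_on S' T -> independent_RVs S S' -> #|T|%:R != 0 :> R ->
  cdf (num_common S S') r = (mean_over_pairs T (fun x => (x%:R <= r)%R%:R))%:E.
Proof.
move=> uS uS' ind T0.
rewrite /cdf /distribution /pushforward; set A := _ @^-1` _.
have mA : measurable A by exact: (measurable_funPTI (num_common S S')).
rewrite (prob_fibers S mA) /mean_over_pairs.
under eq_bigr => F _.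
  rewrite (prob_fibers S'); last by apply: measurableI => //; exact: measurable_fiber.
  under eq_bigr => F' _.
    rewrite (_ : P _ = ((F \in T)%:R * (F' \in T)%:R * (#|F :&: F'|%:R <= r)%R%:R / #|T|%:R ^+ 2)%:E).
      over.
    have [le|lt] := boolP (#|F :&: F'|%:R <= r).
      rewrite (_ : _ `&` _ = S @^-1` [set F] `&` S' @^-1` [set F']).
        rewrite ind // (uniform_prob F uS) // (uniform_prob F' uS') // -EFinM; congr EFin; rewrite /=.
        by field.
      apply/seteqP; split=> w /=; first by case=> -[].
      by move=> [SF SF']; split=> //; split=> //; rewrite /A /= /num_common /common in_itv /= SF SF'.
    rewrite (_ : _ `&` _ = set0) ?measure0 ?mulr0 ?mul0r //.
    apply/seteqP; split=> w //= -[[]]; rewrite /A /= /num_common /common in_itv /= => le SF SF'.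
    by move: le; rewrite SF SF'; apply/negP.
  rewrite sumEFin.
  over.
rewrite sumEFin; congr EFin.
rewrite mulr_suml [RHS]big_mkcond; apply: eq_bigr => F _.
rewrite mulr_suml; case: (F \in T); last by apply: big1 => F' _; rewrite !mul0r.
rewrite [RHS]big_mkcond; apply: eq_bigr => F' _.
by case: (F' \in T); rewrite /= !mul1r ?mul0r.
Qed.

End CommonDistribution.

Lemma sum_indicator (R : numDomainType) (r : R) M x : r < M%:R ->
  (x%:R <= r)%R%:R = \sum_(m < M | m%:R <= r) (x == m)%:R :> R.
Proof.
move=> rM; have [xr|] := boolP (x%:R <= r).
  have xM : (x < M)%N by rewrite -(ltr_nat R); exact: le_lt_trans rM.
  rewrite (bigD1 (Ordinal xM)) //= eqxx big1 ?addr0 // => m /andP[_ nm].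
  by rewrite (_ : (x == m) = false) //; apply: contraNF nm => /eqP E; apply/eqP/val_inj.
move=> xr; rewrite big1 // => m mr; rewrite (_ : (x == m) = false) //.
by apply: contraNF xr => /eqP->.
Qed.

Lemma cdf_poisson_RV (R : realType) (rate r : R) M : 0 < rate -> r < M%:R ->
  cdf (poisson_RV rate) r = (\sum_(m < M | m%:R <= r) poisson_pmf rate m)%:E.
Proof.
move=> rate0 rM; rewrite /cdf /distribution /pushforward /=.
rewrite (_ : _ @^-1` _ = [set m : nat | m%:R <= r]); last first.
  by apply/seteqP; split=> m; rewrite /= in_itv.
have sub : [set m : nat | m%:R <= r] `<=` `I_M.
  by move=> m /= mr; rewrite -(ltr_nat R); exact: le_lt_trans rM.
rewrite /poisson_prob rate0 esum_fset; last 2 first.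
- exact: sub_finite_set sub (finite_II M).
- by move=> m _; rewrite lee_fin poisson_pmf_ge0.
rewrite -sumEFin [RHS]big_mkcond.
rewrite (fsbig_ord _ M (fun m => if m%:R <= r then (poisson_pmf rate m)%:E else 0%E)).
rewrite [LHS]fsbig_mkcond [RHS]fsbig_mkcond; apply: eq_fsbigr => m _; rewrite /patch.
case: ifPn => [|]; first by rewrite inE /= => mr; rewrite mr ifT // inE; exact: sub.
by rewrite notin_setE /= => /negP/negPf ->; case: ifP.
Qed.

Theorem theorem3p2 (R : realType) (d : nat) (hd : (1 < d)%N)
    (c : 'I_d -> R) (hc : forall i, 0 < c i)
    (n : nat -> 'I_d -> nat)
    (hn : (\sum_(i < d) n k i)%N @[k --> \oo] --> \oo)
    (hnc : forall i : 'I_d,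
      ((n k i)%:R / (\sum_(j < d) n k j)%N%:R : R) @[k --> \oo] --> c i)
    (disp : nat -> measure_display)
    (Omega : forall k, measurableType (disp k))
    (P : forall k, probability (Omega k) R)
    (S S' : forall k, {RV (P k) >-> {set {set (multipartite_vertex (n k))}}})
    (hS : forall k, uniform_on (S k) (spanning_trees (multipartite (n k))))
    (hS' : forall k, uniform_on (S' k) (spanning_trees (multipartite (n k))))
    (hind : forall k, independent_RVs (S k) (S' k)) :
  cvg_in_distribution (fun k => num_common (S k) (S' k))
    (poisson_RV (\sum_(i < d) \sum_(j < d | (i < j)%N)
       c i * c j * (2 - c i - c j) ^+ 2
         / ((1 - c i) ^+ 2 * (1 - c j) ^+ 2))).
Proof.
move=> r _; rewrite -/(limit_rate c).
(* All values are natural numbers, so below [r] both laws have at most [M] atoms, a bound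
   independent of [k], and convergence of the point masses suffices. *)
have [M rM] : exists M : nat, r < M%:R.
  by exists (Num.truncn `|r|).+1; apply: le_lt_trans (ler_norm r) (truncnS_gt _).
rewrite (cdf_poisson_RV (limit_rate_gt0 hd hc hn hnc) rM).
pose T k := spanning_trees (multipartite (n k)).
have h : (\sum_(m < M | m%:R <= r) mean_over_pairs (T k) (fun x => (x == m)%:R))
    @[k --> \oo] --> \sum_(m < M | m%:R <= r) poisson_pmf (limit_rate c) m.
  apply: cvg_big => [|m _]; first exact: add_continuous.
  exact: common_pmf_cvg.
have {}h : (\sum_(m < M | m%:R <= r) mean_over_pairs (T k) (fun x => (x == m)%:R))%:E
    @[k --> \oo] --> (\sum_(m < M | m%:R <= r) poisson_pmf (limit_rate c) m)%:E.
  by apply: cvg_EFin => //; near=> k.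
(* The formula for the distribution function needs a spanning tree to exist, which holds for large
   [k]. *)
apply: cvg_trans h; apply: near_eq_cvg; near=> k.
rewrite (cdf_num_common r (hS k) (hS' k) (hind k)); last first.
  by near: k; exact: (near_trees_neq0 hd hc hn hnc).
rewrite -mean_over_pairs_sum; congr (mean_over_pairs (T k) _)%:E.
by apply/funext => x; rewrite (sum_indicator x rM).
Unshelve. all: by end_near. Qed.
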